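(* Let $\mathfrak{g}$ be a finite-dimensional complex Lie algebra carrying a nondegenerate invariant symmetric bilinear form $(\,,\,)$, and let $B:\mathfrak{g}\to\mathfrak{g}$ be a Lie algebra automorphism of finite order $n$ which preserves this form. For $j\in\mathbb{Z}/n\mathbb{Z}$ let $\mathfrak{g}_j=\mathrm{Ker}(B-e^{2\pi i j/n})$, so that $\mathfrak{g}=\bigoplus_j\mathfrak{g}_j$, and set $\mathfrak{l}=\mathfrak{g}_0$. Let $\Omega=(\,,\,)^{-1}\in(S^2\mathfrak{g})^{\mathfrak{g}}$, identify $\mathfrak{l}^*$ with $\mathfrak{l}$ via $(\,,\,)$, and let $D$ be the formal neighbourhood of $0$ in $\mathfrak{l}^*\simeq\mathfrak{l}$. Let $\hat\rho:D\to\mathrm{End}(\mathfrak{g})$ be the function with $\hat\rho(A)|_{\mathfrak{g}_j}=f_j(\mathrm{ad}\,A)$, where $$f_0(s)=\tfrac1s-\tfrac12\coth\big(\tfrac12 s\big),\qquad f_j(s)=-\tfrac12\coth\Big(\tfrac12\big(s+\tfrac{2\pi i j}{n}\big)\Big)\quad(j\neq0),$$ let $\rho:D\to\Lambda^2\mathfrak{g}$ be the map corresponding to $\hat\rho$ under $\mathrm{End}(\mathfrak{g})\simeq\mathfrak{g}^*\otimes\mathfrak{g}\simeq\mathfrak{g}\otimes\mathfrak{g}$, and set $r_B=\frac{\Omega}{2}+\rho$. Then $r_B$ is a dynamical r-matrix, i.e. $r_B\in Dynr(\mathfrak{g},\mathfrak{l},\Omega)$.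
   Context: The functions $f_j$ are expanded as power series in $s$ at $s=0$ (the function $f_0$ is regular there), so that $f_j(\mathrm{ad}\,A)$ is a formal power series in $A$. Under the identification $\mathrm{End}(\mathfrak{g})\simeq\mathfrak{g}^*\otimes\mathfrak{g}\simeq\mathfrak{g}\otimes\mathfrak{g}$ (the last one via $(\,,\,)$), an endomorphism $S$ corresponds to $\sum_i e^i\otimes S(e_i)$, where $(e_i)$ is a basis of $\mathfrak{g}$ and $(e^i)$ is the dual basis, $(e^i,e_j)=\delta_{ij}$; in particular $\Omega=\sum_i e^i\otimes e_i$ corresponds to the identity. Functions on $D$. Let $x_1,\dots,x_r$ be a basis of $\mathfrak{l}$. For a complex vector space $V$, a function $D\to V$ is an element of $V[[x_1,\dots,x_r]]$, where the $x_i$ are regarded as linear coordinates on $\mathfrak{l}^*$ (under $\mathfrak{l}^*\simeq\mathfrak{l}$, $x_i$ is the coordinate $A\mapsto(x_i,A)$). If $V$ is an $\mathfrak{l}$-module, $\mathfrak{l}$ acts on $V[[x_1,\dots,x_r]]$ diagonally, acting on power series by the derivations extending $y\cdot x_i=[y,x_i]$; a function is $\mathfrak{l}$-equivariant if it is annihilated by this action. $\mathfrak{g}\otimes\mathfrak{g}$ carries the adjoint action. Dynamical r-matrices. For $r\in\mathfrak{g}\otimes\mathfrak{g}$ put $CYB(r)=[r^{12},r^{13}]+[r^{12},r^{23}]+[r^{13},r^{23}]\in\mathfrak{g}^{\otimes3}$ (usual leg notation). For a function $r:D\to\mathfrak{g}\otimes\mathfrak{g}$ put $\overline{dr}=\sum_i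 x_i\otimes\frac{\partial r}{\partial x_i}$, and for $x\in\mathfrak{g}^{\otimes3}$ put $\mathrm{Alt}(x)=x^{123}-x^{213}+x^{312}$, where $(a\otimes b\otimes c)^{ijk}$ has $a$ in slot $i$, $b$ in slot $j$, $c$ in slot $k$. $Dynr(\mathfrak{g},\mathfrak{l},\Omega)$ is the set of dynamical r-matrices: $\mathfrak{l}$-equivariant functions $r:D\to\mathfrak{g}\otimes\mathfrak{g}$ with $\mathrm{Alt}(\overline{dr})+CYB(r)=0$ and $r+r^{21}=\Omega$. *)

(* Defs.v *)
From HB Require Import structures.
From mathcomp Require Import all_boot all_order all_algebra.
From mathcomp Require Import all_classical all_reals all_analysis.
From mathcomp Require Import complex.

Set Implicit Arguments.
Unset Strict Implicit.
Unset Printing Implicit Defensive.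

Import Order.TTheory GRing.Theory Num.Theory numFieldNormedType.Exports.

Local Open Scope classical_set_scope.
Local Open Scope ring_scope.
Local Open Scope complex_scope.

(* The complex numbers are R[i] for R : realType; R[i]^o only serves to find *)
(* the norm topology.                                                        *)

Section ComplexFunctions.
Variable R : realType.
Local Notation C := R[i].

Definition cexp (z : C) : C :=
  (expR (complex.Re z))%:C * (cos (complex.Im z) +i* sin (complex.Im z)).

Definition ccosh (z : C) : C := (cexp z + cexp (- z)) / 2.
Definition csinh (z : C) : C := (cexp z - cexp (- z)) / 2.
Definition ccoth (z : C) : C := ccosh z / csinh z.

(* 2 pi i j / n *)
Definition angle (n j : nat) : C := 0 +i* (2 * pi * j%:R / n%:R).

(* j : nat stands for its class in Z/nZ: coth has period pi i. *)
Definition f_ (n j : nat) (s : C) : C :=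
  if j == 0%N then s^-1 - 2^-1 * ccoth (2^-1 * s)
  else - (2^-1 * ccoth (2^-1 * (s + angle n j))).

(* f s = \sum_k a k * s ^+ k for all s != 0 close to 0; the point 0 itself is *)
(* left out because f_ n 0 has a removable singularity there.                 *)
Definition is_expansion0 (f : C -> C) (a : nat -> C) : Prop :=
  \forall s \near (0 : R[i]^o)^',
    series (fun k => a k * s ^+ k : R[i]^o) @ \oo --> (f s : R[i]^o).

(* The coefficients of the (unique) power series expansion of f at 0. *)
Definition expansion0 (f : C -> C) : nat -> C :=
  xget (fun=> 0) [set a | is_expansion0 f a].

End ComplexFunctions.

(* V[[x_1, ..., x_r]], as families of coefficients indexed by exponents. *)
Definition mindex (r : nat) := {ffun 'I_r -> nat}.
Definition pser (r : nat) (V : Type) := mindex r -> V.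

Section FormalPowerSeries.
Variable r : nat.

Definition mdeg (m : mindex r) : nat := (\sum_i m i)%N.
Definition mvar (i : 'I_r) : mindex r := [ffun j => (j == i : nat)].
Definition madd (m p : mindex r) : mindex r := [ffun i => (m i + p i)%N].
Definition msub (m p : mindex r) : mindex r := [ffun i => (m i - p i)%N].

Definition psconst (V : nmodType) (v : V) : pser r V :=
  fun m => if mdeg m == 0%N then v else 0.

(* The product induced by a bilinear map op: the coefficient at m is the sum  *)
(* of op (f p) (g (m - p)) over the p <= m.                                   *)
Definition psmul (U V : Type) (W : nmodType) (op : U -> V -> W)
    (f : pser r U) (g : pser r V) : pser r W :=
  fun m => \sum_(p : {ffun 'I_r -> 'I_(mdeg m).+1}
                 | [forall i, (p i <= m i)%N])
    let p' : mindex r := [ffun i => p i : nat] in op (f p') (g (msub m p')).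

(* d f / d x_i *)
Definition psderiv (V : nmodType) (i : 'I_r) (f : pser r V) : pser r V :=
  fun m => f (madd m (mvar i)) *+ (m i).+1.

(* x_k * f *)
Definition psmulX (V : nmodType) (k : 'I_r) (f : pser r V) : pser r V :=
  fun m => if m k == 0%N then 0 else f (msub m (mvar k)).

Section Endomorphisms.
Variables (K : fieldType) (V : vectType K).

Definition pspow (S : pser r 'End(V)) (k : nat) : pser r 'End(V) :=
  iter k (psmul (fun f g : 'End(V) => (f \o g)%VF) S) (psconst \1%VF).

(* \sum_k a k * S ^ k for S without constant term; then S ^ k only has terms *)
(* of degree >= k, whence the bound on k.                                    *)
Definition pssubst (a : nat -> K) (S : pser r 'End(V)) : pser r 'End(V) :=
  fun m => \sum_(k < (mdeg m).+1) a k *: pspow S k m.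

End Endomorphisms.
End FormalPowerSeries.

(* g (x) g and g (x) g (x) g, by coordinates in the tensor powers of the basis *)
(* vbasis {:g}.                                                                *)
Section Tensors.
Variables (K : fieldType) (g : vectType K).

Local Notation I := 'I_(\dim {:g}).
Local Notation e := (vbasis {:g}).

Definition tensor2 : lmodType K := {ffun I * I -> K^o}.
Definition tensor3 : lmodType K := {ffun I * I * I -> K^o}.

Definition tens2 (u v : g) : tensor2 :=
  [ffun ab : I * I => coord e ab.1 u * coord e ab.2 v : K^o].

Definition tens3 (u v w : g) : tensor3 :=
  [ffun abc : I * I * I =>
    coord e abc.1.1 u * coord e abc.1.2 v * coord e abc.2 w : K^o].

(* The linear map with u (x) v |-> F u v, resp. u (x) v (x) w |-> F u v w, for *)
(* F multilinear.                                                              *)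
Definition lift2 (W : lmodType K) (F : g -> g -> W) (t : tensor2) : W :=
  \sum_(a : I) \sum_(b : I) (t (a, b) : K) *: F e`_a e`_b.

Definition lift3 (W : lmodType K) (F : g -> g -> g -> W) (t : tensor3) : W :=
  \sum_(a : I) \sum_(b : I) \sum_(c : I)
    (t (a, b, c) : K) *: F e`_a e`_b e`_c.

(* t^{21} *)
Definition flip (t : tensor2) : tensor2 := lift2 (fun u v => tens2 v u) t.

(* x^{123} - x^{213} + x^{312} *)
Definition Alt (x : tensor3) : tensor3 :=
  x - lift3 (fun a b c => tens3 b a c) x + lift3 (fun a b c => tens3 b c a) x.

End Tensors.

Section LieAlgebra.
Variables (K : fieldType) (g : vectType K).

Definition is_lie_bracket (br : {bilinear g -> g -> g}) : Prop :=
  (forall x, br x x = 0) /\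
  (forall x y z, br x (br y z) + br y (br z x) + br z (br x y) = 0).

Definition invariant_form (br : {bilinear g -> g -> g})
    (form : {symmetric g}) : Prop :=
  forall x y z, form (br x y) z = form x (br y z).

Definition is_lie_automorphism (br : {bilinear g -> g -> g})
    (B : 'End(g)) : Prop :=
  bijective B /\ (forall x y, B (br x y) = br (B x) (B y)).

Definition has_order (B : 'End(g)) (n : nat) : Prop :=
  [/\ (0 < n)%N, (forall x, iter n B x = x) &
      forall m, (0 < m < n)%N -> ~ (forall x, iter m B x = x)].

Variables (br : {bilinear g -> g -> g}) (form : {symmetric g}).

Definition ad (x : g) : 'End(g) := linfun (br x).

Definition ad2 (y : g) (t : tensor2 g) : tensor2 g :=
  lift2 (fun u v => tens2 (br y u) v + tens2 u (br y v)) t.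

(* [r^{12}, s^{13}] + [r^{12}, s^{23}] + [r^{13}, s^{23}] *)
Definition CYB2 (r s : tensor2 g) : tensor3 g :=
  lift2 (fun a b => lift2 (fun c d =>
    tens3 (br a c) b d + tens3 a (br b c) d + tens3 a c (br b d)) s) r.

(* The vectors x^i in the span of X with form x^i X`_j = (i == j), computed   *)
(* from the Gram matrix of X (invertible when the form is nondegenerate on    *)
(* the span of the free family X).                                            *)
Definition gram (k : nat) (X : k.-tuple g) : 'M[K]_k :=
  \matrix_(i, j) form X`_i X`_j.

Definition dual_basis (k : nat) (X : k.-tuple g) (i : 'I_k) : g :=
  \sum_(j < k) invmx (gram X) i j *: X`_j.

(* \sum_i e^i (x) S e_i *)
Definition tensor_of_End (S : 'End(g)) : tensor2 g :=
  \sum_i tens2 (dual_basis (vbasis {:g}) i) (S (vbasis {:g})`_i).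

Definition Omega : tensor2 g := tensor_of_End \1%VF.

Variables (l : {vspace g}) (r : nat) (X : r.-tuple g).

(* The members of X are a basis of l and also the coordinates on l^* ~ l;     *)
(* y acts on the coordinates by y . x_i = [y, x_i] = \sum_k c_k x_k.          *)
Definition equivariant (rm : pser r (tensor2 g)) : Prop :=
  forall y, y \in l -> forall m,
    ad2 y (rm m) +
    \sum_(i < r) \sum_(k < r)
      coord X k (br y X`_i) *: psmulX k (psderiv i rm) m = 0.

Definition dbar (rm : pser r (tensor2 g)) : pser r (tensor3 g) :=
  fun m => \sum_(i < r) lift2 (tens3 X`_i) (psderiv i rm m).

Definition CYB (rm : pser r (tensor2 g)) : pser r (tensor3 g) :=
  psmul CYB2 rm rm.

Definition Dynr (Om : tensor2 g) (rm : pser r (tensor2 g)) : Prop :=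
  [/\ equivariant rm,
      (forall m, Alt (dbar rm m) + CYB rm m = 0) &
      (forall m, rm m + flip (rm m) = psconst Om m)].

(* ad A for the generic A \in l. As X`_i is the coordinate A |-> form X`_i A, *)
(* A = \sum_i x_i x^i with (x^i) the basis of l dual to X.                    *)
Definition ad_generic : pser r 'End(g) :=
  fun m => \sum_(i < r) if m == mvar i then ad (dual_basis X i) else 0.

End LieAlgebra.

Section RMatrix.
Variables (R : realType) (g : vectType R[i]).
Variables (br : {bilinear g -> g -> g}) (form : {symmetric g}).
Variables (B : 'End(g)) (n : nat).

Definition gj (j : nat) : {vspace g} := passmx.leigenspace B (cexp (angle R n j)).

Variables (r : nat) (X : r.-tuple g).

(* The function D -> End(g) which is f_j(ad A) on g_j, for all j in Z/nZ. *)
Definition rhohat : pser r 'End(g) :=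
  fun m => xget 0 [set S : 'End(g) |
    forall j, (j < n)%N -> forall v, v \in gj j ->
      S v = pssubst (expansion0 (f_ n j)) (ad_generic br form X) m v].

Definition rho : pser r (tensor2 g) := fun m => tensor_of_End form (rhohat m).

Definition r_B : pser r (tensor2 g) :=
  fun m => psconst (2^-1 *: Omega form) m + rho m.

End RMatrix.

(* Main.v *)
Require Import Defs.
Set Warnings "-all".
From HB Require Import structures.
From mathcomp Require Import all_boot all_order all_algebra.
From mathcomp Require Import all_classical all_reals all_analysis.
From mathcomp Require Import complex ring lra zify.

Set Implicit Arguments.
Unset Strict Implicit.
Unset Printing Implicit Defensive.

Import Order.TTheory GRing.Theory Num.Theory numFieldNormedType.Exports.

Local Open Scope ring_scope.
Local Open Scope complex_scope.

(** Pairing a tensor with u (x) v through the form turns the tensor of an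
    endomorphism S into (S u, v), and these pairings determine the tensor. In
    this way r_B becomes the endomorphism 1/2 + rhohat. The operator ad A is
    skew for the form, g_j pairs nontrivially only with g_(-j), and
    f_(-j)(-s) = - f_j(s) since coth is odd with period pi i; so rhohat is
    skew, and r + r^21 = Omega (r_B_symmetric_part).

    A formal power series is determined by the values of its homogeneous
    components at the points of l (ev_eq0). At a point, the generic ad A
    becomes one operator D = ad y with y in l, and a power series in ad A
    becomes the sequence of the multiples c_d D ^ d. Equivariance
    (r_B_equivariant) then says that the commutator of ad z with D ^ d is the
    derivative of D ^ d in the direction [z, y], which holds since ad [z, y]
    is the commutator of ad z and D.

    Paired with a in g_i, b in g_j, c in g_k, the equation
    Alt(dr) + CYB(r) = 0 reads, with rho for the value of rhohat and with d_a the derivative in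
    the direction a, which is 0 unless a lies in l = g_0,

      (d_a rho b, c) + (d_b rho c, a) + (d_c rho a, b)
        + ([rho b, rho c], a) + ([rho c, rho a], b) + ([rho a, rho b], c)
        + 1/4 ([a, b], c) = 0.

    If i + j + k is not 0 mod n, every term vanishes because B multiplies it
    by a nontrivial root of unity. Otherwise let s1, s2, s3 stand for D acting
    on a, b, c. By invariance s1 + s2 + s3 = 0, and (d_a rho b, c) is the
    divided difference (f_j(s2) - f_j(-s3)) / (s2 + s3), that is
    - (f_j(s2) + f_k(s3)) / s1, since k = - j when i = 0. So the equation is

      f_i f_j + f_j f_k + f_k f_i + 1/4
        = delta_i (f_j + f_k) / s1 + delta_j (f_k + f_i) / s2
          + delta_k (f_i + f_j) / s3

    with delta_i = 1 if i = 0 and 0 otherwise. This is the addition theorem of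
    coth for f_j - delta_j / s = - 1/2 coth ((s + theta_j) / 2)
    (f_coth_identity).

    The analytic identity is used on lines: for numbers al + be + ga = 0,
    compare the coefficients of s at (ga s, al s, be s)
    (expansion0_f_identity). The resulting polynomial identity in al, with be
    = 1, is carried to the trilinear form by a linear functional (lam,
    trilinear_identity). The expansions of the f_j exist because the
    coefficients of a reciprocal power series grow at most geometrically
    (expansion0V). *)

(** * Convolution of coefficient sequences *)

Section Convolution.
Variable K : fieldType.
Implicit Types a b c : nat -> K.

Definition conv a b : nat -> K :=
  fun k => \sum_(i < k.+1) a i * b (k - i)%N.

Definition scale_coef a (z : K) : nat -> K := fun k => a k * z ^+ k.

(** The expansion of the constant 1/2, which turns rho into the coefficients
    of r. *)
Definition half : nat -> K := fun k => if k is 0 then 2^-1 else 0.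

Lemma convC a b k : conv a b k = conv b a k.
Proof.
rewrite /conv (reindex_inj rev_ord_inj) /=; apply: eq_bigr => i _.
by rewrite subSS mulrC subKn // -ltnS.
Qed.

Lemma convDl a b c k : conv (fun i => a i + b i) c k = conv a c k + conv b c k.
Proof. by rewrite -big_split; apply: eq_bigr => i _; rewrite mulrDl. Qed.

Lemma convNl a b k : conv (fun i => - a i) b k = - conv a b k.
Proof. by rewrite -sumrN; apply: eq_bigr => i _; rewrite mulNr. Qed.

Lemma conv_halfl a k : conv half a k = 2^-1 * a k.
Proof.
rewrite /conv big_ord_recl subn0 big1 ?addr0 // => i _.
by rewrite mul0r.
Qed.

Lemma convDr a b c k : conv c (fun i => a i + b i) k = conv c a k + conv c b k.
Proof. by rewrite convC convDl !(convC _ c). Qed.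

Lemma convNr a b k : conv b (fun i => - a i) k = - conv b a k.
Proof. by rewrite convC convNl convC. Qed.

(** The products of r = 1/2 + rho and its transpose 1/2 - rho that occur in
    CYB (r) reduce to the products of rho: the terms of degree one in rho
    cancel, and the three constants leave 1/4. *)
Lemma conv_half_shift a b c k :
  conv (fun i => - b i + half i) (fun i => - c i + half i) k
  - conv (fun i => a i + half i) (fun i => - c i + half i) k
  + conv (fun i => a i + half i) (fun i => b i + half i) k
  = conv a b k + conv b c k + conv c a k + (if k is 0 then 4^-1 else 0).
Proof.
have -> : (if k is 0 then 4^-1 else 0) = 2^-1 * half k.
  by case: k => [|k] /=; rewrite ?mulr0 // -invfM -natrM.
rewrite !(convDl, convDr, convNl, convNr, conv_halfl) !(convC _ half) !conv_halfl.
by rewrite (convC c a); ring.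
Qed.

End Convolution.

(** * Expansions at 0 of complex functions *)

Section ComplexSeries.
Local Open Scope classical_set_scope.
Variable R : realType.
Local Notation C := R[i].
Implicit Types (a b c : nat -> C) (s z : C) (f g : C -> C) (u v : nat -> C).

Import Normc.

Lemma normC_def z : `|z| = (normc z)%:C. Proof. by []. Qed.

Lemma normc_ge0 z : 0 <= normc z.
Proof. by case: z => x y /=; exact: sqrtr_ge0. Qed.

Lemma normc_sum (I : Type) (r : seq I) (P : pred I) (F : I -> C) :
  normc (\sum_(i <- r | P i) F i) <= \sum_(i <- r | P i) normc (F i).
Proof.
rewrite -lecR rmorph_sum /=.
exact: (@ler_norm_sum _ C).
Qed.

Lemma normcX z n : normc (z ^+ n) = normc z ^+ n.
Proof.
elim: n => [|n ihn]; first by rewrite !expr0 normc1.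
by rewrite !exprS normcM ihn.
Qed.

Lemma normc_gt0 z : z != 0 -> 0 < normc z.
Proof.
move=> z0; rewrite lt_neqAle normc_ge0 andbT eq_sym.
by apply: contra z0 => /eqP/eq0_normc ->.
Qed.

(** Convergence for the norm topology; a name keeps the regular module R[i]^o
    out of the statements. *)
Definition tends u z := (u : nat -> C^o) @ \oo --> (z : C^o).

Lemma tendsP u z :
  tends u z <-> forall e : R, 0 < e -> \forall n \near \oo, normc (z - u n) < e.
Proof.
rewrite /tends; split.
  move/cvgrPdist_lt => h e e0.
  have /h : (0 : C) < e%:C by rewrite ltcR.
  by apply: filterS => n; rewrite normC_def ltcR.
move=> h; apply/cvgrPdist_lt => /= e e0.
have er : (complex.Re e)%:C = e by apply: RRe_real; exact: gtr0_real.
have /h : 0 < complex.Re e by rewrite -ltcR er.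
by apply: filterS => n; rewrite normC_def -er ltcR.
Qed.

Lemma dnbhs0P (P : C -> Prop) :
  (\forall s \near (0 : C^o)^', P s) <->
  exists2 e : R, 0 < e & forall s, s != 0 -> normc s < e -> P s.
Proof.
split.
  rewrite /dnbhs /within /= => /nbhs_ballP [e /= e0 h].
  have er : (complex.Re e)%:C = e by apply: RRe_real; exact: gtr0_real.
  exists (complex.Re e); first by rewrite -ltcR er.
  move=> s s0 se; apply: h => //.
  by rewrite /ball /= sub0r normrN normC_def -er ltcR.
move=> [e e0 h].
have e0' : (0 : C) < e%:C by rewrite ltcR.
near=> s; apply: h; first by near: s; exact: (@nbhs_dnbhs_neq C^o).
rewrite -ltcR -normC_def; near: s.
exact: (@dnbhs0_lt C C^o).
Unshelve. all: by end_near. Qed.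

Lemma tends_unique u y z : tends u y -> tends u z -> y = z.
Proof. by move=> h1 h2; exact: (cvg_unique (@norm_hausdorff _ C^o) h1 h2). Qed.

Lemma tends_cst z : tends (fun=> z) z.
Proof. exact: cvg_cst. Qed.
Arguments tends_cst z : clear implicits.

Lemma tendsD u v y z : tends u y -> tends v z ->
  tends (fun n => u n + v n) (y + z).
Proof. by move=> h1 h2; exact: (cvgD h1 h2). Qed.

Lemma tendsM u v y z : tends u y -> tends v z ->
  tends (fun n => u n * v n) (y * z).
Proof. by move=> h1 h2; exact: (@cvgM C^o nat \oo _ u v y z h1 h2). Qed.

Lemma tends_ext u v z : tends u z -> u =1 v -> tends v z.
Proof. by move=> h /funext <-. Qed.

Lemma tends_geometric u (A : R) :
  (forall n, normc (u n) <= A * 2^-1 ^+ n) -> tends u 0.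
Proof.
move=> h; apply/tendsP => e e0.
have : (fun n => A * 2^-1 ^+ n : R) @ \oo --> (0 : R).
  rewrite -(mulr0 A); apply: cvgM; first exact: cvg_cst.
  by apply: cvg_expr; rewrite ger0_norm ?invr_ge0 // invf_lt1 // ltr1n.
move/cvgrPdist_lt => /(_ e e0); apply: filterS => n /=.
rewrite !sub0r normrN normcN; apply: le_lt_trans.
exact: le_trans (h n) (ler_norm _).
Qed.

Definition psum a s n : C := \sum_(k < n) a k * s ^+ k.

(** The exponent k.+1 lets a single constant M bound all the coefficients, the
    first one included. *)
Definition geometric_bound a :=
  exists2 M : R, 0 < M & forall k, normc (a k) <= M ^+ k.+1.

Lemma is_expansion0E f a :
  is_expansion0 f a <-> \forall s \near (0 : C^o)^', tends (psum a s) (f s).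
Proof.
rewrite /is_expansion0 /tends.
suff e s : series (fun k => a k * s ^+ k : C^o) = psum a s.
  by split; apply: filterS => s; rewrite e.
by apply/funext => n; rewrite /series /= big_mkord.
Qed.

(** The general term of a series that converges at one point s != 0 tends to
    0, hence is bounded by a multiple of |s| ^- k; the finitely many first
    terms are absorbed in M. *)
Lemma expansion0_geometric f a : is_expansion0 f a -> geometric_bound a.
Proof.
move=> /is_expansion0E /dnbhs0P [e e0 h].
have s0 : ((e / 2)%:C : C) != 0.
  by rewrite fmorph_eq0 mulf_neq0 ?invr_eq0 ?pnatr_eq0 // gt_eqF.
have ns : normc ((e / 2)%:C : C) = e / 2.
  rewrite /= expr0n addr0 sqrtr_sqr ger0_norm //.
  by rewrite divr_ge0 // ltW.
have /h : normc ((e / 2)%:C : C) < e by rewrite ns; lra.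
move=> /(_ s0); set s : C := (e / 2)%:C => lim.
have [N hN] : exists N, forall k, (N <= k)%N -> normc (a k) * (e / 2) ^+ k <= 1.
  move/tendsP: lim => /(_ 2^-1) [|N _ hN]; first by rewrite invr_gt0.
  exists N => k Nk; rewrite -ns -normcX -normcM.
  have -> : a k * s ^+ k = (f s - psum a s k) - (f s - psum a s k.+1).
    by rewrite /psum big_ord_recr /=; ring.
  have h1 := hN k Nk; have h2 := hN k.+1 (leqW Nk).
  have := le_normcD (f s - psum a s k) (- (f s - psum a s k.+1)).
  rewrite normcN /= in h1 h2 * => h3.
  apply: le_trans h3 _; lra.
pose M := (e / 2)^-1 + 1 + \sum_(k < N) normc (a k).
have M1 : 1 <= M.
  rewrite /M -addrA [1 + _]addrC addrA lerDr addr_ge0 // ?invr_ge0; first lra.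
  by apply: sumr_ge0 => i _; exact: normc_ge0.
exists M; first by lra.
move=> k; have [kN|Nk] := ltnP k N.
  apply: le_trans (_ : M <= _).
    rewrite /M (bigD1 (Ordinal kN)) //= addrCA lerDl addr_ge0 //.
      by rewrite addr_ge0 // invr_ge0; lra.
    by apply: sumr_ge0 => i _; exact: normc_ge0.
  by rewrite exprS ler_peMr //; [lra | exact: exprn_ege1].
apply: le_trans (_ : M ^+ k <= _); last first.
  by rewrite exprS ler_peMl // exprn_ge0 //; lra.
apply: le_trans (_ : (e / 2)^-1 ^+ k <= _).
  rewrite exprVn -[leRHS]mul1r ler_pdivlMr ?hN //.
  by rewrite exprn_gt0 // divr_gt0.
apply: lerXn2r; rewrite ?nnegrE ?invr_ge0; try lra.
rewrite /M -addrA lerDl addr_ge0 //.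
by apply: sumr_ge0 => i _; exact: normc_ge0.
Qed.

Lemma sum_triangle (V : zmodType) (F : nat -> nat -> V) n :
  \sum_(k < n) \sum_(i < k.+1) F i (k - i)%N =
  \sum_(i < n) \sum_(j < n - i) F i j.
Proof.
elim: n => [|n ihn]; first by rewrite !big_ord0.
rewrite big_ord_recr /= ihn [in RHS]big_ord_recr /= subSnn big_ord1.
rewrite [in LHS]big_ord_recr /= subnn addrA; congr (_ + _).
rewrite -big_split; apply: eq_bigr => i _ /=.
by rewrite subSn 1?ltnW // big_ord_recr.
Qed.

(** The products u_i v_j with i, j < n that are missing from the partial sum
    of the convolution have i + j >= n, so there are at most n ^ 2 of them,
    each at most A B 8 ^- n; and n ^ 2 <= 4 ^ n, so that what is missing is at
    most A B 2 ^- n. *)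
Lemma cauchy_product_tends u v (A B : R) :
  (forall k, normc (u k) <= A * 8^-1 ^+ k) ->
  (forall k, normc (v k) <= B * 8^-1 ^+ k) ->
  tends (fun n => (\sum_(k < n) u k) * (\sum_(k < n) v k)
                  - \sum_(k < n) \sum_(i < k.+1) u i * v (k - i)%N) 0.
Proof.
move=> hu hv; apply: (@tends_geometric _ (A * B)) => n.
have A0 : 0 <= A by have := hu 0; rewrite expr0 mulr1; apply: le_trans (normc_ge0 _).
have B0 : 0 <= B by have := hv 0; rewrite expr0 mulr1; apply: le_trans (normc_ge0 _).
rewrite (@sum_triangle _ (fun i j => u i * v j)) mulr_suml -sumrB.
have -> : \sum_(i < n) (u i * (\sum_(k < n) v k) - \sum_(j < n - i) u i * v j)
        = \sum_(i < n) \sum_(j < n | (n - i <= j)%N) u i * v j.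
  apply: eq_bigr => i _; rewrite mulr_sumr.
  rewrite (bigID (fun j : 'I_n => (n - i <= j)%N)) /= -addrA.
  rewrite [X in _ + (X - _)](_ : _ = \sum_(j < n - i) u i * v j) ?subrr ?addr0 //.
  rewrite (big_ord_widen n (fun j => u i * v j)) ?leq_subr //.
  by apply: eq_bigl => j; rewrite -ltnNge.
have q0 : (0 : R) <= 8^-1 by rewrite invr_ge0.
apply: (le_trans (normc_sum _ _ _)).
apply: le_trans (_ : \sum_(i < n) \sum_(j < n) A * B * 8^-1 ^+ n <= _).
  apply: ler_sum => i _; apply: (le_trans (normc_sum _ _ _)).
  rewrite big_mkcond /=; apply: ler_sum => j _; case: ifP => ij; last first.
    by rewrite mulr_ge0 ?mulr_ge0 ?exprn_ge0.
  rewrite normcM; apply: le_trans (ler_pM (normc_ge0 _) (normc_ge0 _) (hu i) (hv j)) _.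
  rewrite mulrACA -exprD ler_wpM2l ?mulr_ge0 // ler_wiXn2l //.
    by rewrite invf_le1 // ler1n.
  by rewrite -leq_subLR.
rewrite !sumr_const !card_ord -!mulrnA -mulrnAr ler_wpM2l ?mulr_ge0 //.
rewrite -mulr_natr -[8]/((2 * 4)%N%:R) natrM invfM exprMn -mulrA.
rewrite ler_piMr ?exprn_ge0 ?invr_ge0 // exprVn mulrC ler_pdivrMr ?exprn_gt0 //.
rewrite mul1r -natrX ler_nat (_ : 4 = 2 * 2)%N // expnMn.
by rewrite leq_mul // ltnW // ltn_expl.
Qed.

Lemma geometric_near a : geometric_bound a -> exists2 A : R, 0 <= A &
  \forall s \near (0 : C^o)^', forall k, normc (a k * s ^+ k) <= A * 8^-1 ^+ k.
Proof.
move=> [M M0 h]; exists M; first exact: ltW.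
apply/dnbhs0P; exists (8^-1 / M); first by rewrite divr_gt0 // invr_gt0.
move=> s _ sM k; rewrite normcM normcX.
apply: le_trans (ler_wpM2r _ (h k)) _; first by rewrite exprn_ge0 ?normc_ge0.
rewrite exprS -mulrA -exprMn ler_wpM2l //; first exact: ltW.
apply: lerXn2r; rewrite ?nnegrE ?mulr_ge0 ?normc_ge0 ?invr_ge0 //; first exact: ltW.
by rewrite mulrC -ler_pdivlMr // ltW.
Qed.

Lemma psum_conv a b s n :
  psum (conv a b) s n
  = \sum_(k < n) \sum_(i < k.+1) (a i * s ^+ i) * (b (k - i)%N * s ^+ (k - i)).
Proof.
apply: eq_bigr => k _; rewrite mulr_suml; apply: eq_bigr => i _.
by rewrite mulrACA -exprD subnKC // -ltnS.
Qed.

Lemma expansion0_near f g a : is_expansion0 f a ->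
  (\forall s \near (0 : C^o)^', f s = g s) -> is_expansion0 g a.
Proof.
by move=> /[swap] h /is_expansion0E h1; apply/is_expansion0E; apply: filterS2 h h1 => s ->.
Qed.

Lemma expansion0D f g a b : is_expansion0 f a -> is_expansion0 g b ->
  is_expansion0 (fun s => f s + g s) (fun k => a k + b k).
Proof.
move=> /is_expansion0E ha /is_expansion0E hb; apply/is_expansion0E.
apply: filterS2 ha hb => s h1 h2; apply: (tends_ext (tendsD h1 h2)) => n.
by rewrite -big_split; apply: eq_bigr => k _; rewrite mulrDl.
Qed.

Lemma expansion0Z f a z : is_expansion0 f a ->
  is_expansion0 (fun s => z * f s) (fun k => z * a k).
Proof.
move=> /is_expansion0E ha; apply/is_expansion0E.
apply: filterS ha => s h1; apply: (tends_ext (tendsM (tends_cst z) h1)) => n.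
by rewrite mulr_sumr; apply: eq_bigr => k _; rewrite mulrA.
Qed.

Lemma expansion0M f g a b : is_expansion0 f a -> is_expansion0 g b ->
  is_expansion0 (fun s => f s * g s) (conv a b).
Proof.
move=> ha hb.
have [A _ ga] := geometric_near (expansion0_geometric ha).
have [B _ gb] := geometric_near (expansion0_geometric hb).
move/is_expansion0E: ha => ha; move/is_expansion0E: hb => hb.
apply/is_expansion0E.
apply: filterS2 (filterI ha ga) (filterI hb gb) => s [sa sga] [sb sgb].
have h := cauchy_product_tends sga sgb.
rewrite -[f s * g s]addr0 -(mulr0 (-1)).
apply: (tends_ext (tendsD (tendsM sa sb) (tendsM (tends_cst (-1)) h))).
by move=> n; rewrite psum_conv /psum; ring.
Qed.

Lemma expansion0_cst z : is_expansion0 (fun=> z) (fun k => if k is 0 then z else 0).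
Proof.
apply/is_expansion0E; near=> s; apply/tendsP => e e0.
exists 1%N => // -[//|n] _.
by rewrite /psum big_ord_recl /= expr0 mulr1 big1 ?addr0 ?subrr ?normc0 // => i _; rewrite mul0r.
Unshelve. all: by end_near. Qed.

Lemma expansion0_id : is_expansion0 (fun s : C => s) (fun k => (k == 1%N)%:R).
Proof.
apply/is_expansion0E; near=> s; apply/tendsP => e e0.
exists 2%N => // -[//|[//|n]] _.
rewrite /psum !big_ord_recl /= mul0r add0r expr1 mul1r big1 ?addr0 ?subrr ?normc0 //.
by move=> i _; rewrite mul0r.
Unshelve. all: by end_near. Qed.

Lemma expansion0_scale f a z : z != 0 -> is_expansion0 f a ->
  is_expansion0 (fun s => f (z * s)) (fun k => a k * z ^+ k).
Proof.
move=> z0 /is_expansion0E /dnbhs0P [e e0 h]; apply/is_expansion0E/dnbhs0P.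
exists (e / normc z); first by rewrite divr_gt0 // normc_gt0.
move=> s s0; rewrite ltr_pdivlMr ?normc_gt0 // mulrC -normcM => hs.
apply: (tends_ext (h _ (mulf_neq0 z0 s0) hs)) => n.
by apply: eq_bigr => k _; rewrite exprMn mulrA.
Qed.

(** Division by s drops the vanishing constant coefficient. *)
Lemma expansion0_shift f a : a 0%N = 0 -> is_expansion0 f a ->
  is_expansion0 (fun s => f s / s) (fun k => a k.+1).
Proof.
move=> a0 /is_expansion0E /dnbhs0P [e e0 h]; apply/is_expansion0E/dnbhs0P.
exists e; [exact: e0 | move=> s s0 hs].
have := tendsM (h _ s0 hs) (tends_cst s^-1).
move/tendsP => lim; apply/tendsP => d d0.
have [N _ hN] := lim d d0; exists N => // n Nn.
have := hN n.+1 (leqW Nn); rewrite /psum big_ord_recl a0 mul0r add0r mulr_suml.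
rewrite (eq_bigr (fun k : 'I_n => a k.+1 * s ^+ k)) // => k _.
by rewrite lift0 exprSr -mulrA mulfK.
Qed.

Lemma sum_8V_le2 n : \sum_(k < n) (8^-1 : R) ^+ k <= 2.
Proof.
suff h : \sum_(k < n) (8^-1 : R) ^+ k <= 2 - 2 * 8^-1 ^+ n.
  by apply: le_trans h _; rewrite gerBl mulr_ge0 // exprn_ge0 // invr_ge0.
elim: n => [|n ihn]; first by rewrite big_ord0 expr0; lra.
rewrite big_ord_recr /= exprS.
have : (0 : R) <= 8^-1 ^+ n by rewrite exprn_ge0 // invr_ge0.
by lra.
Qed.

(** Outside its constant term the series is O(s), so a value 0 arbitrarily
    close to the origin forces the constant term to be smaller than any bound.
    *)
Lemma expansion0_zero_const f a : is_expansion0 f a ->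
  (\forall s \near (0 : C^o)^', f s = 0) -> a 0%N = 0.
Proof.
move=> ha f0; have [M M0 hM] := expansion0_geometric ha.
apply/eqP/negPn/negP => /normc_gt0; set al := normc _ => al0.
suff : \forall s \near (0 : C^o)^', False by move/filter_ex => [].
have sM : \forall s \near (0 : C^o)^', normc s <= 8^-1 / M.
  apply/dnbhs0P; exists (8^-1 / M); last by move=> s _ /ltW.
  by rewrite divr_gt0 // invr_gt0.
have sal : \forall s \near (0 : C^o)^', normc s <= al / 2 / (2 * M ^+ 2).
  apply/dnbhs0P; exists (al / 2 / (2 * M ^+ 2)); last by move=> s _ /ltW.
  by rewrite divr_gt0 ?divr_gt0 // mulr_gt0 // exprn_gt0.
have ha' := proj1 (is_expansion0E _ _) ha.
apply: filterS2 (filterI f0 ha') (filterI sM sal) => s [fs +] [{}sM {}sal].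
rewrite fs => /tendsP /(_ (al / 2)) [|N _ /(_ N.+1 (leqnSn N))].
  by rewrite divr_gt0.
rewrite sub0r normcN /psum big_ord_recl expr0 mulr1 => hN.
move: hN; set rest := \sum_(i < N) _ => hN.
have hrest : normc rest <= al / 2.
  apply: (le_trans (normc_sum _ _ _)).
  apply: le_trans (_ : \sum_(k < N) M ^+ 2 * normc s * 8^-1 ^+ k <= _).
    apply: ler_sum => k _; rewrite normcM normcX.
    apply: le_trans (ler_wpM2r _ (hM _)) _; first by rewrite exprn_ge0 ?normc_ge0.
    rewrite lift0 exprS [normc s ^+ _]exprS exprS expr2 -!mulrA !(ler_wpM2l (ltW M0)) //.
    rewrite mulrCA ler_wpM2l ?normc_ge0 // -exprMn.
    apply: lerXn2r; rewrite ?nnegrE ?mulr_ge0 ?normc_ge0 ?invr_ge0 //; first exact: ltW.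
    by rewrite mulrC -ler_pdivlMr.
  rewrite -mulr_sumr; apply: le_trans (ler_wpM2l _ (sum_8V_le2 N)) _.
    by rewrite mulr_ge0 ?normc_ge0 // exprn_ge0 // ltW.
  move: sal; rewrite ler_pdivlMr ?mulr_gt0 ?exprn_gt0 // => sal.
  by apply: le_trans sal; rewrite [M ^+ 2 * _]mulrC -mulrA [M ^+ 2 * 2]mulrC.
have := le_normcD (a 0%N + rest) (- rest).
rewrite normcN addrK -/al /= in hN * => h.
move: (le_lt_trans h (ltr_leD hN hrest)); lra.
Qed.

Lemma expansion0_eq0 a : is_expansion0 (fun=> 0 : C) a -> forall k, a k = 0.
Proof.
move=> ha k; elim: k a ha => [|k ihk] a ha.
  by apply: (expansion0_zero_const ha); exact: nearW.
apply: (ihk (fun k => a k.+1)).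
have a0 : a 0%N = 0 by apply: (expansion0_zero_const ha); exact: nearW.
apply: (expansion0_near (expansion0_shift a0 ha)).
by apply: nearW => s; rewrite mul0r.
Qed.

(** The difference expands 0; its constant coefficient vanishes, and dividing
    by s passes to the next one. *)
Lemma expansion0_unique f a b : is_expansion0 f a -> is_expansion0 f b -> a =1 b.
Proof.
move=> ha hb k; apply/subr0_eq.
rewrite -mulN1r; apply: (@expansion0_eq0 (fun k => a k + -1 * b k)).
apply: (expansion0_near (expansion0D ha (expansion0Z (-1) hb))).
by apply: nearW => s; rewrite mulN1r subrr.
Qed.

(** * Reciprocals of power series *)

(** The recurrence for the coefficients of a reciprocal calls all the previous
    values, so the sequence is built as a growing list. *)
Fixpoint recip_seq b n : seq C :=
  if n is n'.+1 then
    let q := recip_seq b n' in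
    rcons q (if n' is 0 then (b 0)^-1 else
      - (b 0)^-1 * \sum_(i < n') b i.+1 * nth 0 q (n' - i.+1))
  else [::].

Definition recip b n := nth 0 (recip_seq b n.+1) n.

Lemma size_recip_seq b n : size (recip_seq b n) = n.
Proof. by elim: n => //= n ihn; rewrite size_rcons ihn. Qed.

Lemma nth_recip_seq b n k : (k < n)%N -> nth 0 (recip_seq b n) k = recip b k.
Proof.
elim: n => // n ihn; rewrite ltnS leq_eqVlt => /orP[/eqP -> //|kn].
by rewrite /= nth_rcons size_recip_seq kn ihn.
Qed.

Lemma recip0 b : recip b 0 = (b 0%N)^-1. Proof. by []. Qed.

Lemma recipS b n :
  recip b n.+1 = - (b 0%N)^-1 * \sum_(i < n.+1) b i.+1 * recip b (n - i)%N.
Proof.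
rewrite {1}/recip -[recip_seq b n.+2]/(rcons (recip_seq b n.+1)
  (- (b 0%N)^-1 * \sum_(i < n.+1) b i.+1 * nth 0 (recip_seq b n.+1) (n.+1 - i.+1))).
rewrite nth_rcons size_recip_seq ltnn eqxx; congr (_ * _); apply: eq_bigr => i _.
by rewrite (@nth_recip_seq b n.+1) // subSS ltnS leq_subr.
Qed.

Lemma conv_recip b : b 0%N != 0 ->
  conv b (recip b) =1 (fun k => if k is 0 then 1 else 0).
Proof.
move=> b0 [|n]; first by rewrite /conv big_ord1 recip0 divff.
rewrite /conv big_ord_recl subn0 recipS mulrA mulrN divff // mulN1r.
by apply/eqP; rewrite addrC subr_eq0; apply/eqP/eq_bigr => i _; rewrite lift0.
Qed.

(** If the coefficients of b / b_0 are at most P ^ i for i > 0, the recurrence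
    bounds those of the reciprocal by (2 P) ^ k, since the sum of the P ^ i (2
    P) ^ (k - i) over 0 < i <= k is (2 P) ^ k - P ^ k. *)
Lemma recip_geometric b : b 0%N != 0 -> geometric_bound b ->
  geometric_bound (recip b).
Proof.
move=> /normc_gt0; set be := normc _ => be0 [M M0 hM].
(* be ^-1 M ^ (i + 1) is at most P ^ i as soon as i > 0. *)
pose P := M * (1 + M / be).
have P0 : 0 < P by rewrite mulr_gt0 // addr_gt0 // divr_gt0.
have hP i : be^-1 * normc (b i.+1) <= P ^+ i.+1.
  rewrite mulrC ler_pdivrMr //; apply: (le_trans (hM _)).
  rewrite exprSr exprMn -[leRHS]mulrA ler_wpM2l ?exprn_ge0 ?(ltW M0) //.
  rewrite -ler_pdivrMr //; apply: le_trans (_ : (1 + M / be) ^+ 1 <= _).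
    by rewrite expr1 lerDr.
  by rewrite ler_weXn2l // lerDl divr_ge0 // ltW.
clearbody P.
suff h k : normc (recip b k) <= be^-1 * (2 * P) ^+ k.
  exists (2 * P + be^-1); first by apply: addr_gt0; [exact: mulr_gt0 | rewrite invr_gt0].
  move=> k; apply: (le_trans (h k)); rewrite exprS.
  apply: ler_pM; rewrite ?invr_ge0 ?exprn_ge0 ?mulr_ge0 ?(ltW be0) ?(ltW P0) //.
    by rewrite lerDr mulr_ge0 // ltW.
  apply: lerXn2r; rewrite ?nnegrE ?addr_ge0 ?mulr_ge0 ?invr_ge0 ?(ltW P0) ?(ltW be0) //.
  by rewrite lerDl invr_ge0 ltW.
elim/ltn_ind: k => -[|n] ihn; first by rewrite recip0 normcV expr0 mulr1.
rewrite recipS normcM normcN normcV ler_wpM2l ?invr_ge0 ?(ltW be0) //.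
apply: (le_trans (normc_sum _ _ _)).
apply: le_trans (_ : \sum_(i < n.+1) P * ((2 * P) ^+ (n - i) * P ^+ i) <= _).
  apply: ler_sum => i _; rewrite normcM.
  apply: le_trans (ler_wpM2l (normc_ge0 _) (ihn (n - i)%N _)) _.
    by rewrite ltnS leq_subr.
  rewrite mulrCA mulrA [leRHS]mulrCA -exprS [leRHS]mulrC ler_wpM2r //.
  by rewrite exprn_ge0 // mulr_ge0 // ltW.
have -> : \sum_(i < n.+1) P * ((2 * P) ^+ (n - i) * P ^+ i)
          = (2 * P) ^+ n.+1 - P ^+ n.+1.
  by rewrite subrXX -mulr_sumr; congr (_ * _); ring.
by rewrite gerBl exprn_ge0 // ltW.
Qed.

Lemma tendsM_bounded u v (A : R) : tends u 0 -> (forall n, normc (v n) <= A) ->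
  tends (fun n => u n * v n) 0.
Proof.
move=> /tendsP hu hv; apply/tendsP => e e0.
have A0 : 0 <= A := le_trans (normc_ge0 _) (hv 0%N).
have A1 : 0 < A + 1 by lra.
have /hu : 0 < e / (A + 1) by rewrite divr_gt0.
apply: filterS => n; rewrite !sub0r !normcN normcM ltr_pdivlMr //.
apply: le_lt_trans; rewrite ler_wpM2l ?normc_ge0 //.
by apply: (le_trans (hv n)); rewrite lerDl.
Qed.

(** The partial sums of the product of both series tend to 1, and the partial
    sums of the second one are bounded; together these facts give at once that
    g s != 0 and that the second series converges to 1 / g s. *)
Lemma expansion0V g b : b 0%N != 0 -> is_expansion0 g b ->
  is_expansion0 (fun s => (g s)^-1) (recip b).
Proof.
move=> b0 hb.
have [A _ ga] := geometric_near (expansion0_geometric hb).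
have [B B0 gb] := geometric_near (recip_geometric b0 (expansion0_geometric hb)).
move/is_expansion0E: hb => hb; apply/is_expansion0E.
apply: filterS2 (filterI hb ga) gb => s [sb sga] sgb.
have h := cauchy_product_tends sga sgb.
have bnd n : normc (psum (recip b) s n) <= B * 2.
  apply: (le_trans (normc_sum _ _ _)).
  apply: le_trans (_ : \sum_(k < n) B * 8^-1 ^+ k <= _); first exact: ler_sum.
  by rewrite -mulr_sumr; apply: ler_wpM2l => //; exact: sum_8V_le2.
have h0 : tends (fun n => (g s + -1 * psum b s n) * psum (recip b) s n) 0.
  apply: tendsM_bounded bnd; 
  rewrite (_ : 0 = g s + -1 * g s); last by rewrite mulN1r subrr.
  by apply: tendsD; [exact: (tends_cst _) | apply: tendsM sb; exact: (tends_cst _)].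
have h1 : tends (psum (conv b (recip b)) s) 1.
  apply/tendsP => e e0; exists 1%N => // -[//|n] _.
  rewrite /psum big_ord_recl conv_recip // expr0 mulr1 big1 ?addr0 ?subrr ?normc0 //.
  by move=> i _; rewrite conv_recip // mul0r.
have h2 : tends (fun n => g s * psum (recip b) s n) 1.
  rewrite -[1]addr0 -[0]addr0 addrA; apply: (tends_ext (tendsD (tendsD h1 h) h0)) => n.
  by rewrite psum_conv /psum; ring.
have gs0 : g s != 0.
  apply/eqP => gs; suff /eqP : 0 = 1 :> C by rewrite eq_sym oner_eq0.
  apply: (tends_unique _ h2).
  rewrite (_ : (fun n => _) = (fun=> 0)); first exact: (tends_cst _).
  by apply/funext => n; rewrite gs mul0r.
have := tendsM (tends_cst (g s)^-1) h2; rewrite mulr1 => h3.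
refine (tends_ext h3 _) => n.
by rewrite mulrA mulVf // mul1r.
Qed.

(** * The complex exponential *)

Lemma normc_real (x : R) : normc (x%:C : C) = `|x|.
Proof. by rewrite /= expr0n addr0 sqrtr_sqr. Qed.

Lemma tends_real (r : nat -> R) (l : R) :
  r @ \oo --> l -> tends (fun n => (r n)%:C) l%:C.
Proof.
move=> /cvgrPdist_lt h; apply/tendsP => e /h; apply: filterS => n.
by rewrite -rmorphB normc_real.
Qed.

Lemma tends_complex (p q : nat -> R) (x y : R) : p @ \oo --> x -> q @ \oo --> y ->
  tends (fun n => p n +i* q n) (x +i* y).
Proof.
move=> /tends_real hp /tends_real hq; rewrite [x +i* y]complexE.
apply: (tends_ext (tendsD hp (tendsM (tends_cst 'i) hq))) => n.
by rewrite [RHS]complexE.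
Qed.

Lemma imag_real (y : R) : 0 +i* y = 'i * y%:C :> C.
Proof. by apply/eqP; rewrite eq_complex; apply/andP; split; apply/eqP => /=; ring. Qed.

Lemma cexp_imag_term (y : R) k :
  (0 +i* y) ^+ k / k`!%:R = cos_coeff y k +i* sin_coeff y k :> C.
Proof.
have iX m : ('i : C) ^+ m.*2 = ((-1) ^+ m : R)%:C.
  by rewrite -mul2n exprM sqr_i rmorphXn rmorphN rmorph1.
have -> : 0 +i* y = 'i * y%:C :> C.
  exact: imag_real.
have -> : ('i * y%:C) ^+ k / k`!%:R = ('i : C) ^+ k * (y ^+ k / k`!%:R : R)%:C.
  by rewrite exprMn rmorphM fmorphV rmorph_nat rmorphXn mulrA.
rewrite /cos_coeff /sin_coeff /=; set r := y ^+ k / _.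
rewrite -!mulrA -/r -[in LHS](odd_double_half k) addnC exprD iX.
case ok : (odd k) => /=.
  have -> : k.-1./2 = k./2 by rewrite -[in LHS](odd_double_half k) ok /= doubleK.
  rewrite expr1; apply/eqP; rewrite eq_complex /=.
  by apply/andP; split; apply/eqP; ring.
rewrite expr0 mulr1 -exprnP; apply/eqP; rewrite eq_complex /=.
by apply/andP; split; apply/eqP; ring.
Qed.

Lemma cvg_series_cos (y : R) : series (cos_coeff y) @ \oo --> cos y.
Proof. by rewrite unlock; exact: is_cvg_series_cos_coeff. Qed.

Lemma cvg_series_sin (y : R) : series (sin_coeff y) @ \oo --> sin y.
Proof. by rewrite unlock; exact: is_cvg_series_sin_coeff. Qed.

Lemma tends_cexp_imag (y : R) :
  tends (fun n => \sum_(k < n) (0 +i* y) ^+ k / k`!%:R) (cos y +i* sin y).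
Proof.
have h := tends_complex (@cvg_series_cos y) (@cvg_series_sin y).
refine (tends_ext h _) => n.
rewrite [LHS]complexE /series /= !big_mkord !rmorph_sum mulr_sumr -big_split.
by apply: eq_bigr => k _; rewrite cexp_imag_term [RHS]complexE.
Qed.

Lemma tends_cexp_real (x : R) :
  tends (fun n => \sum_(k < n) x%:C ^+ k / k`!%:R) (expR x)%:C.
Proof.
have h := tends_real (@is_cvg_series_exp_coeff R x).
refine (tends_ext h _) => n.
rewrite /series /= big_mkord rmorph_sum.
by apply: eq_bigr => k _; rewrite /exp_coeff /= rmorphM fmorphV rmorph_nat rmorphXn.
Qed.

Lemma Re_le_normc s : `|complex.Re s| <= normc s.
Proof.
case: s => x y /=; rewrite -sqrtr_sqr ler_wsqrtr // lerDl; exact: sqr_ge0.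
Qed.

Lemma Im_le_normc s : `|complex.Im s| <= normc s.
Proof.
case: s => x y /=; rewrite -sqrtr_sqr ler_wsqrtr // lerDr; exact: sqr_ge0.
Qed.

Lemma normc_exp_term s k : normc s <= 8^-1 ->
  normc (s ^+ k / k`!%:R) <= 1 * 8^-1 ^+ k.
Proof.
move=> hs; rewrite mul1r normcM normcV normcX.
have -> : normc (k`!%:R : C) = k`!%:R by rewrite -(rmorph_nat (real_complex R)) normc_real normr_nat.
rewrite ler_pdivrMr ?ltr0n ?fact_gt0 //.
apply: le_trans (_ : 8^-1 ^+ k <= _).
  by apply: lerXn2r; rewrite ?nnegrE ?normc_ge0 ?invr_ge0.
by rewrite ler_peMr ?exprn_ge0 ?invr_ge0 // ler1n fact_gt0.
Qed.

(** The function cexp is given by its real and imaginary parts: the real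
    exponential, cosine and sine series give the expansions at Re s and at i
    Im s, and the Cauchy product with the binomial formula puts them together.
    *)
Lemma expansion0_cexp : is_expansion0 (@cexp R) (fun k => (k`!%:R)^-1).
Proof.
apply/is_expansion0E/dnbhs0P; exists 8^-1; first by rewrite invr_gt0.
move=> s _ /ltW hs; set x := complex.Re s; set y := complex.Im s.
have hx : normc (x%:C : C) <= 8^-1.
  by rewrite normc_real; apply: le_trans hs; exact: Re_le_normc.
have hy : normc (0 +i* y : C) <= 8^-1.
  rewrite /= expr0n add0r sqrtr_sqr; apply: le_trans hs; exact: Im_le_normc.
have h := cauchy_product_tends (fun k => normc_exp_term k hx)
  (fun k => normc_exp_term k hy).
have h1 := tendsM (@tends_cexp_real x) (@tends_cexp_imag y).
have := tendsD h1 (tendsM (tends_cst (-1)) h).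
rewrite mulr0 addr0 => h2; refine (tends_ext h2 _) => n.
rewrite mulN1r opprB addrC subrK; apply: eq_bigr => k _.
rewrite [s in RHS]complexE -/x -/y.
have -> : 'i * y%:C = 0 +i* y :> C.
  by rewrite imag_real.
rewrite addrC exprDn mulr_sumr; apply: eq_bigr => i _.
have ik : (i <= k)%N by rewrite -ltnS.
have f0 m : (m`!%:R : C) != 0 by rewrite pnatr_eq0 -lt0n fact_gt0.
rewrite -mulr_natr -(bin_fact ik) !natrM.
have b0 : ('C(k, i)%:R : C) != 0 by rewrite pnatr_eq0 -lt0n bin_gt0.
field; by rewrite !f0 b0.
Qed.

End ComplexSeries.

(** * The functions f_j *)

Section CothExpansion.
Local Open Scope classical_set_scope.
Variable R : realType.
Local Notation C := R[i].
Implicit Types (s z u w : C) (f g : C -> C).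

Lemma cexpD s z : cexp (s + z) = cexp s * cexp z.
Proof.
case: s z => x y [x' y']; rewrite /cexp /= expRD cosD sinD.
by apply/eqP; rewrite eq_complex; apply/andP; split; apply/eqP => /=; ring.
Qed.

Lemma cexp0 : cexp (0 : C) = 1.
Proof.
rewrite /cexp /= expR0 cos0 sin0.
by apply/eqP; rewrite eq_complex; apply/andP; split; apply/eqP => /=; ring.
Qed.

Lemma cexp_neq0 s : cexp s != 0.
Proof.
apply/eqP => s0; have /eqP := cexp0; rewrite -(subrr s) cexpD s0 mul0r.
by rewrite eq_sym oner_eq0.
Qed.

Lemma cexpN s : cexp (- s) = (cexp s)^-1.
Proof.
apply: (mulIf (cexp_neq0 s)); rewrite -cexpD addNr cexp0 mulVf //.
exact: cexp_neq0.
Qed.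

Lemma angleD n i j : angle R n (i + j) = angle R n i + angle R n j.
Proof.
apply/eqP; rewrite eq_complex /= natrD addr0 eqxx /=.
by rewrite mulrDr mulrDl.
Qed.

Lemma cexp_angleE n j : cexp (angle R n j) = cexp (angle R n 1) ^+ j.
Proof.
elim: j => [|j ihj]; last by rewrite -addn1 angleD cexpD ihj exprD expr1.
by rewrite expr0 -cexp0; congr cexp; apply/eqP; rewrite eq_complex /= mulr0 mul0r eqxx.
Qed.

Lemma cexp_angle0 n : cexp (angle R n 0) = 1.
Proof. by rewrite cexp_angleE expr0. Qed.

Lemma cexp_angle_order n : (0 < n)%N -> cexp (angle R n 1) ^+ n = 1.
Proof.
move=> n0; rewrite -cexp_angleE /cexp /= mulfK ?pnatr_eq0 -?lt0n //.
rewrite [2 * pi]mulrC mulr_natr cos2pi sin2pi expR0.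
by apply/eqP; rewrite eq_complex; apply/andP; split; apply/eqP => /=; ring.
Qed.

Lemma cexp_angle_dvd n j : (0 < n)%N -> (n %| j)%N -> cexp (angle R n j) = 1.
Proof.
move=> n0 /dvdnP [m ->].
by rewrite cexp_angleE mulnC exprM cexp_angle_order // expr1n.
Qed.

(** The real part would give cos theta = 1 with 0 < theta < 2 pi, whereas cos
    theta = 1 - 2 sin (theta / 2) ^ 2. *)
Lemma cexp_angle_neq1 n j : (0 < j < n)%N -> cexp (angle R n j) != 1.
Proof.
move=> /andP[j0 jn]; apply/eqP => /(congr1 (@complex.Re R)).
rewrite /cexp /= expR0 mul1r mul0r subr0; set th := _ / _ => h.
have n0 : (0 : R) < n%:R by rewrite ltr0n (leq_trans _ jn).
have th0 : 0 < th / 2.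
  by rewrite !divr_gt0 // mulr_gt0 ?ltr0n // mulr_gt0 // pi_gt0.
have thpi : th / 2 < pi.
  rewrite /th -!mulrA [2 * _]mulrC -!mulrA gtr_pMr ?pi_gt0 //.
  rewrite [2^-1 * 2]mulVf ?pnatr_eq0 // mulr1 ltr_pdivrMr // mul1r ltr_nat //.
have := sin_gt0_pi (x := th / 2); rewrite th0 thpi => /(_ isT) sth.
have : cos (th / 2 *+ 2) = 1 by rewrite -mulr_natr divfK ?pnatr_eq0.
rewrite cos_mulr2n cos2sin2 => hc.
have : sin (th / 2) ^+ 2 = 0 by lra.
by move/eqP; rewrite expf_eq0 /= gt_eqF.
Qed.

Lemma ccothE u : ccoth (2^-1 * u) = (cexp u + 1) / (cexp u - 1).
Proof.
have -> : cexp u = cexp (2^-1 * u) ^+ 2 by rewrite expr2 -cexpD; congr cexp; field.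
rewrite /ccoth /ccosh /csinh cexpN; have := cexp_neq0 (2^-1 * u).
move: (cexp _) => t t0.
have [t1|t1] := eqVneq (t ^+ 2 - 1) 0.
  have -> : t - t^-1 = 0.
    by apply: (mulIf t0); rewrite mul0r mulrBl mulVf // -expr2.
  by rewrite t1 !mul0r !invr0 !mulr0.
by field; rewrite t1 t0.
Qed.

(** This is -1/2 coth (s / 2) as a function of u = exp s; in this form the
    period of coth is built in. *)
Definition hcoth u : C := - (2^-1 * ((u + 1) / (u - 1))).

(** All the f_j are -1/2 coth ((s + theta_j) / 2), up to the pole 1 / s
    removed when j = 0. *)
Lemma f_E n j s : f_ n j s =
  (j == 0)%N%:R / s + hcoth (cexp (angle R n j) * cexp s).
Proof.
rewrite /f_ !ccothE /hcoth; case: eqP => [->|_].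
  by rewrite cexp_angle0 /= !mul1r.
by rewrite /= mul0r add0r addrC cexpD [cexp (angle _ _ _) * _]mulrC addrC.
Qed.

Lemma hcoth_inv u : u != 0 -> u != 1 -> hcoth u^-1 = - hcoth u.
Proof.
move=> u0 u1; rewrite /hcoth; field.
by rewrite subr_eq0 u1 u0 /= mulN1r subr_eq0 eq_sym.
Qed.

(** The addition theorem of coth in exponential form: the left-hand side is (u
    v w - 1) / ((u - 1) (v - 1) (w - 1)). *)
Lemma hcoth_add u v w : u != 1 -> v != 1 -> w != 1 -> u * v * w = 1 ->
  hcoth u * hcoth v + hcoth v * hcoth w + hcoth w * hcoth u + 4^-1 = 0.
Proof.
rewrite -subr_eq0 -[v == 1]subr_eq0 -[w == 1]subr_eq0 => u1 v1 w1 uvw.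
apply: etrans (_ : (u * v * w - 1) / ((u - 1) * (v - 1) * (w - 1)) = _).
  by rewrite /hcoth; field; rewrite u1 v1 w1.
by rewrite uvw subrr mul0r.
Qed.

Lemma expansion0_neq0 g b : b 0%N != 0 -> is_expansion0 g b ->
  \forall s \near (0 : C^o)^', g s != 0.
Proof.
move=> b0 hb; have := expansion0M hb (expansion0V b0 hb).
move/is_expansion0E; apply: filterS => s h.
have h1 : tends (psum (conv b (recip b)) s) 1.
  apply/tendsP => e e0; exists 1%N => // -[//|n] _.
  rewrite /psum big_ord_recl conv_recip // expr0 mulr1 big1 ?addr0 ?subrr ?Normc.normc0 //.
  by move=> i _; rewrite conv_recip // mul0r.
apply/eqP => gs; have := tends_unique h h1; rewrite gs mul0r => /eqP.
by rewrite eq_sym oner_eq0.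
Qed.

Definition cexp_affine w z : nat -> C :=
  fun k => w * (k`!%:R)^-1 + if k is 0 then z else 0.

Lemma expansion0_cexp_affine w z :
  is_expansion0 (fun s => w * cexp s + z) (cexp_affine w z).
Proof. exact: expansion0D (expansion0Z w (expansion0_cexp R)) (expansion0_cst z). Qed.

Lemma expansion0_cexp_sub1_div :
  is_expansion0 (fun s : C => (cexp s - 1) / s) (fun k => ((k.+1)`!%:R)^-1).
Proof.
have h := expansion0_cexp_affine 1 (-1).
have h0 : cexp_affine 1 (-1) 0%N = 0 by rewrite /cexp_affine /= invr1 mulr1 subrr.
have := expansion0_shift h0 h.
rewrite (_ : (fun k => cexp_affine 1 (-1) k.+1) = fun k => ((k.+1)`!%:R)^-1).
  by move=> h1; refine (expansion0_near h1 _); apply: nearW => s; rewrite mul1r.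
by apply/funext => k; rewrite /cexp_affine mul1r addr0.
Qed.

Lemma near0_neq0 : \forall s \near (0 : C^o)^', s != 0.
Proof. exact: (@nbhs_dnbhs_neq C^o). Qed.

Lemma near0_cexp_neq1 w : \forall s \near (0 : C^o)^', w * cexp s != 1.
Proof.
have [->|w1] := eqVneq w 1.
  have h0 : ((1`!%:R)^-1 : C) != 0 by rewrite invr_eq0 oner_eq0.
  have := expansion0_neq0 h0 expansion0_cexp_sub1_div; apply: filterS => s.
  by apply: contra => /eqP; rewrite mul1r => ->; rewrite subrr mul0r.
have h0 : cexp_affine w (-1) 0%N != 0 by rewrite /cexp_affine /= invr1 mulr1 subr_eq0.
have := expansion0_neq0 h0 (expansion0_cexp_affine w (-1)); apply: filterS => s.
by rewrite subr_eq0.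
Qed.

Lemma near0_scale z (P : C -> Prop) : z != 0 ->
  (\forall s \near (0 : C^o)^', P s) -> \forall s \near (0 : C^o)^', P (z * s).
Proof.
move=> z0 /dnbhs0P [e e0 h]; apply/dnbhs0P.
exists (e / Normc.normc z); first by rewrite divr_gt0 // normc_gt0.
move=> s s0; rewrite ltr_pdivlMr ?normc_gt0 // mulrC -Normc.normcM => hs.
by apply: h hs; rewrite mulf_neq0.
Qed.

(** For j != 0 the denominator exp (s + theta_j) - 1 does not vanish at 0. For
    j = 0 it vanishes to first order, and the subtracted pole 1 / s makes the
    numerator (exp s - 1) / s - (exp s + 1) / 2 vanish to first order too, so
    that a factor s can be cancelled. *)
Lemma f_has_expansion n j : (j < n)%N -> exists a, is_expansion0 (f_ (R := R) n j) a.
Proof.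
move=> jn; have [->|j0] := eqVneq j 0%N; last first.
  set w := cexp (angle R n j).
  have w1 : w != 1 by rewrite cexp_angle_neq1 // lt0n j0.
  have h0 : cexp_affine w (-1) 0%N != 0 by rewrite /cexp_affine /= invr1 mulr1 subr_eq0.
  have := expansion0M (expansion0_cexp_affine w 1)
    (expansion0V h0 (expansion0_cexp_affine w (-1))).
  move/(expansion0Z (- 2^-1)) => h; eexists; refine (expansion0_near h _).
  apply: nearW => s; rewrite f_E (negbTE j0) mul0r add0r.
  by rewrite /hcoth mulNr.
have g0 : ((1`!%:R)^-1 : C) != 0 by rewrite invr_eq0 oner_eq0.
have hG := expansion0_cexp_sub1_div.
have hN := expansion0D hG (expansion0Z (- 2^-1) (expansion0_cexp_affine 1 1)).
have N0 : (1`!%:R)^-1 + - 2^-1 * cexp_affine 1 1 0%N = 0.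
  rewrite /cexp_affine -[(1`!)%:R]/(1 : C) invr1.
  by field.
have := expansion0M (expansion0_shift N0 hN) (expansion0V g0 hG).
move=> h; eexists; refine (expansion0_near h _).
apply: filterS2 near0_neq0 (expansion0_neq0 g0 hG) => s s0 g1.
have e1 : cexp s - 1 != 0 by apply: contra g1 => /eqP ->; rewrite mul0r.
by rewrite f_E /= cexp_angle0 /hcoth; field; rewrite e1 s0.
Qed.

Lemma expansion0P n j : (j < n)%N ->
  is_expansion0 (f_ n j) (expansion0 (f_ (R := R) n j)).
Proof.
move=> /f_has_expansion [a ha]; rewrite /expansion0.
by case: xgetP => [b -> //|/(_ a)].
Qed.

Local Notation c n j := (expansion0 (f_ (R := R) n j)).

Lemma dvdn_add_lt n j k : (j < n)%N -> (k < n)%N -> (n %| j + k)%N ->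
  (j == 0)%N = (k == 0)%N.
Proof.
move=> jn kn; have [->|j0] := eqVneq j 0%N.
  by rewrite add0n => /dvdn_leq; case: (posnP k) => // k0 /(_ isT); rewrite leqNgt kn.
case: (posnP k) => // ->; rewrite addn0 => /dvdn_leq; rewrite lt0n j0 => /(_ isT).
by rewrite leqNgt jn.
Qed.

(** f_(-j) (- s) = - f_j s, because coth is odd with period pi i. *)
Lemma expansion0_f_opp n j k d : (j < n)%N -> (k < n)%N -> (n %| j + k)%N ->
  c n k d * (-1) ^+ d = - c n j d.
Proof.
move=> jn kn jk; have n0 : (0 < n)%N by apply: leq_trans jn.
have N1 : (-1 : C) != 0 by rewrite oppr_eq0 oner_eq0.
have h1 := expansion0_scale N1 (expansion0P kn).
have h2 := expansion0Z (-1) (expansion0P jn).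
have := expansion0_unique (expansion0_near h1 _) h2 => ->; first by rewrite mulN1r.
apply: filterS (near0_cexp_neq1 (cexp (angle R n j))) => s s1.
rewrite !f_E (dvdn_add_lt jn kn jk) !mulN1r invrN mulrN opprD; congr (_ + _).
have u0 : cexp (angle R n j) * cexp s != 0 by rewrite mulf_neq0 ?cexp_neq0.
rewrite -hcoth_inv //; congr hcoth; apply: (mulIf u0); rewrite (mulVf u0).
rewrite mulrACA -!cexpD addNr addr0 -angleD cexp_angle_dvd //.
by rewrite addnC.
Qed.

Lemma conv_id (a : nat -> C) d : conv (fun k => (k == 1%N)%:R) a d.+1 = a d.
Proof.
rewrite /conv !big_ord_recl /= mul0r add0r mul1r subn1 big1 ?addr0 // => i _.
by rewrite mul0r.
Qed.

(** Expand the addition theorem for f_j - delta_(j,0) / s. The products of two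
    poles cancel: at least two of i, j, k vanish only if all three do, and
    then 1/(s1 s2) + 1/(s2 s3) + 1/(s3 s1) = (s1 + s2 + s3) / (s1 s2 s3) = 0.
    The factor s clears the remaining simple poles. *)
Lemma f_coth_identity n i j k (al be ga s : C) :
  (i < n)%N -> (j < n)%N -> (k < n)%N -> (n %| i + j + k)%N ->
  ga + al + be = 0 -> al != 0 -> be != 0 -> ga != 0 -> s != 0 ->
  cexp (angle R n i) * cexp (ga * s) != 1 ->
  cexp (angle R n j) * cexp (al * s) != 1 ->
  cexp (angle R n k) * cexp (be * s) != 1 ->
  let f1 := f_ n i (ga * s) in let f2 := f_ n j (al * s) in
  let f3 := f_ n k (be * s) in
  s * (f1 * f2 + f2 * f3 + f3 * f1 + 4^-1) =
  (i == 0)%N%:R / ga * (f2 + f3) + (j == 0)%N%:R / al * (f3 + f1)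
  + (k == 0)%N%:R / be * (f1 + f2).
Proof.
move=> il jl kl ijk abg al0 be0 ga0 s0 u1 v1 w1 /=; rewrite !f_E.
have n0 : (0 < n)%N by apply: leq_trans il.
have uvw : cexp (angle R n i) * cexp (ga * s) * (cexp (angle R n j) * cexp (al * s))
  * (cexp (angle R n k) * cexp (be * s)) = 1.
  rewrite -(cexp_angle_dvd n0 ijk) -!cexpD !angleD; congr cexp.
  by rewrite -[RHS]addr0 -(mul0r s) -abg; ring.
have := hcoth_add u1 v1 w1 uvw.
move: (hcoth (_ * cexp (ga * s))) (hcoth (_ * cexp (al * s)))
  (hcoth (_ * cexp (be * s))) => F1 F2 F3 hF.
have F4 : 4^-1 = - (F1 * F2 + F2 * F3 + F3 * F1) 
  by apply/eqP; rewrite -subr_eq0 opprK addrC hF.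
have -> : ga = - (al + be) by apply/eqP; rewrite -addr_eq0 addrA abg.
have ab0 : al + be != 0.
  by apply: contra ga0 => /eqP ab; rewrite -abg -addrA ab addr0.
rewrite F4; have [i0|i0] := eqVneq i 0%N.
  move: ijk; rewrite i0 add0n => /(dvdn_add_lt jl kl) ->; case: eqP => _ /=;
  by field; rewrite ?s0 ?al0 ?be0 ?mulN1r ?oppr_eq0 ?ab0.
have [j0|j0] := eqVneq j 0%N.
  move: ijk; rewrite j0 addn0 => /(dvdn_add_lt il kl) <-; rewrite (negbTE i0) /=.
  by field; rewrite ?s0 ?al0 ?be0 ?ab0.
have [k0|k0] := eqVneq k 0%N => /=; field; rewrite ?s0 ?al0 ?be0 ?ab0 //.
Qed.

(** The coefficients of s ^ (d + 1) in the previous identity. *)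
Lemma expansion0_f_identity n i j k (al be ga : C) d :
  (i < n)%N -> (j < n)%N -> (k < n)%N -> (n %| i + j + k)%N ->
  ga + al + be = 0 -> al != 0 -> be != 0 -> ga != 0 ->
  let a1 := scale_coef (c n i) ga in let a2 := scale_coef (c n j) al in
  let a3 := scale_coef (c n k) be in
  conv a1 a2 d + conv a2 a3 d + conv a3 a1 d + (if d is 0 then 4^-1 else 0) =
  (i == 0)%N%:R / ga * (a2 d.+1 + a3 d.+1) + (j == 0)%N%:R / al * (a3 d.+1 + a1 d.+1)
  + (k == 0)%N%:R / be * (a1 d.+1 + a2 d.+1).
Proof.
move=> il jl kl ijk abg al0 be0 ga0 a1 a2 a3.
have h1 := expansion0_scale ga0 (expansion0P il).
have h2 := expansion0_scale al0 (expansion0P jl).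
have h3 := expansion0_scale be0 (expansion0P kl).
have hl := expansion0M (expansion0_id R)
  (expansion0D (expansion0D (expansion0D (expansion0M h1 h2) (expansion0M h2 h3))
    (expansion0M h3 h1)) (expansion0_cst (4^-1))).
have hr := expansion0D (expansion0D (expansion0Z ((i == 0)%N%:R / ga) (expansion0D h2 h3))
  (expansion0Z ((j == 0)%N%:R / al) (expansion0D h3 h1)))
  (expansion0Z ((k == 0)%N%:R / be) (expansion0D h1 h2)).
have e := expansion0_unique (expansion0_near hl _) hr.
rewrite -[LHS]/((fun d => conv a1 a2 d + conv a2 a3 d + conv a3 a1 d
  + (if d is 0 then 4^-1 else 0)) d) -(conv_id _ d) -[RHS]e //.
apply: filterS2 (filterI near0_neq0 (near0_scale ga0 (near0_cexp_neq1 (cexp (angle R n i)))))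
 (filterI (near0_scale al0 (near0_cexp_neq1 (cexp (angle R n j))))
  (near0_scale be0 (near0_cexp_neq1 (cexp (angle R n k))))) => s [s0 u1] [v1 w1].
exact: (f_coth_identity il jl kl ijk abg al0 be0 ga0 s0 u1 v1 w1).
Qed.

End CothExpansion.

(** * Functions that are linear *)

Section Linear.
Variable K : numFieldType.

Lemma linear_fun_sum (V W : lmodType K) (L : V -> W) (J : Type) (r : seq J) (P : pred J)
  (F : J -> V) : linear L -> L (\sum_(i <- r | P i) F i) = \sum_(i <- r | P i) L (F i).
Proof.
move=> hL; pose L' : {linear V -> W} := HB.pack L (GRing.isLinear.Build _ _ _ _ L hL).
by rewrite -[L]/(L' : V -> W) linear_sum.
Qed.

Lemma linear_fun_scale (V W : lmodType K) (L : V -> W) k (u : V) :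
  linear L -> L (k *: u) = k *: L u.
Proof.
move=> hL; pose L' : {linear V -> W} := HB.pack L (GRing.isLinear.Build _ _ _ _ L hL).
by rewrite -[L]/(L' : V -> W) linearZ.
Qed.

Lemma linear_funMn (V W : lmodType K) (L : V -> W) (u : V) k :
  linear L -> L (u *+ k) = L u *+ k.
Proof.
move=> hL; pose L' : {linear V -> W} := HB.pack L (GRing.isLinear.Build _ _ _ _ L hL).
exact: (raddfMn L').
Qed.

Lemma linear_fun0 (V W : lmodType K) (L : V -> W) : linear L -> L 0 = 0.
Proof.
move=> hL; pose L' : {linear V -> W} := HB.pack L (GRing.isLinear.Build _ _ _ _ L hL).
exact: (raddf0 L').
Qed.

End Linear.

(** * Homogeneous components and their values *)

Section Evaluation.
Variables (r : nat) (K : numFieldType).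
Implicit Types (m p q : mindex r) (d : nat) (x : 'I_r -> K) (U V W : lmodType K).

Definition mle p m := [forall i, (p i <= m i)%N].

(** All multi-indices with entries at most D: sums over different degrees can
    be compared once they run over a common finite box. *)
Definition mbox D : seq (mindex r) :=
  [seq ([ffun i => (u i : nat)] : mindex r) | u : {ffun 'I_r -> 'I_D.+1}].

Lemma mbox_uniq D : uniq (mbox D).
Proof.
rewrite map_inj_uniq ?enum_uniq // => u v /ffunP uv; apply/ffunP => i.
by apply: val_inj; have := uv i; rewrite !ffunE.
Qed.

Lemma mem_mbox D m : (m \in mbox D) = [forall i, (m i <= D)%N].
Proof.
apply/mapP/forallP => [[u _ ->] i|h]; first by rewrite ffunE -ltnS.
exists [ffun i => inord (m i)]; first by rewrite mem_enum.
by apply/ffunP => i; rewrite !ffunE inordK // ltnS.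
Qed.

Lemma leq_mdeg m i : (m i <= mdeg m)%N.
Proof. by rewrite /mdeg (bigD1 i) //= leq_addr. Qed.

Lemma mdeg_mbox D m : (mdeg m <= D)%N -> m \in mbox D.
Proof.
by move=> mD; rewrite mem_mbox; apply/forallP => i; apply: leq_trans (leq_mdeg m i) mD.
Qed.

Lemma mdegD p q : mdeg (madd p q) = (mdeg p + mdeg q)%N.
Proof. by rewrite /mdeg -big_split; apply: eq_bigr => i _; rewrite ffunE. Qed.

Lemma mdeg_mvar (i : 'I_r) : mdeg (mvar i) = 1%N.
Proof.
rewrite /mdeg (bigD1 i) //= ffunE eqxx big1 ?addn0 // => j /negbTE ji.
by rewrite ffunE ji.
Qed.

Lemma mle_mdeg p m : mle p m -> (mdeg p <= mdeg m)%N.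
Proof. by move=> /forallP h; apply: leq_sum => i _; exact: h. Qed.

Lemma mleD p q : mle p (madd p q).
Proof. by apply/forallP => i; rewrite ffunE leq_addr. Qed.

Lemma maddK p q : msub (madd p q) p = q.
Proof. by apply/ffunP => i; rewrite !ffunE addKn. Qed.

Lemma msubK p m : mle p m -> madd p (msub m p) = m.
Proof. by move=> /forallP h; apply/ffunP => i; rewrite !ffunE subnKC. Qed.

Lemma maddC p q : madd p q = madd q p.
Proof. by apply/ffunP => i; rewrite !ffunE addnC. Qed.

Lemma maddI p : injective (madd p).
Proof. by move=> q q' /(congr1 (fun m => msub m p)); rewrite !maddK. Qed.

Lemma big_mbox (W : nmodType) D E (P Q : pred (mindex r)) (F : mindex r -> W) :
  {in mbox D, forall m, P m -> (m \in mbox E) && Q m} ->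
  {in mbox E, forall m, Q m -> (m \in mbox D) && P m} ->
  \sum_(m <- mbox D | P m) F m = \sum_(m <- mbox E | Q m) F m.
Proof.
move=> h1 h2; rewrite -big_filter -[RHS]big_filter; apply: perm_big.
apply: uniq_perm; rewrite ?filter_uniq ?mbox_uniq // => m; rewrite !mem_filter.
by apply/andP/andP => -[hp hm]; [have := h1 m hm hp | have := h2 m hm hp] => /andP[].
Qed.

Lemma big_mbox_shift (W : nmodType) D E p (P Q : pred (mindex r)) (F : mindex r -> W) :
  {in mbox D, forall m, P m -> mle p m && (msub m p \in mbox E) && Q (msub m p)} ->
  {in mbox E, forall q, Q q -> (madd p q \in mbox D) && P (madd p q)} ->
  \sum_(m <- mbox D | P m) F m = \sum_(q <- mbox E | Q q) F (madd p q).
Proof.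
move=> h1 h2; rewrite -big_filter -[RHS]big_filter -(big_map (madd p) predT F).
apply: perm_big; apply: uniq_perm.
- by rewrite filter_uniq ?mbox_uniq.
- by rewrite map_inj_uniq ?filter_uniq ?mbox_uniq //; exact: maddI.
move=> m; rewrite mem_filter; apply/andP/mapP => [[hp hm]|[q]].
  have /andP[/andP[pm mE] qm] := h1 m hm hp.
  by exists (msub m p); rewrite ?mem_filter ?mE ?qm // msubK.
by rewrite mem_filter => /andP[qq qE] ->; have /andP[] := h2 q qE qq.
Qed.

Lemma psmulE D (U V : Type) (W : nmodType) (op : U -> V -> W)
    (f : pser r U) (g : pser r V) m : (mdeg m <= D)%N ->
  psmul op f g m = \sum_(p <- mbox D | mle p m) op (f p) (g (msub m p)).
Proof.
move=> mD; transitivity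
  (\sum_(p <- mbox (mdeg m) | mle p m) op (f p) (g (msub m p))).
  rewrite /mbox big_map big_enum_cond /=; apply: eq_bigl => u.
  by apply: eq_forallb => i; rewrite ffunE.
apply: big_mbox => p _ pm; rewrite pm andbT; apply: mdeg_mbox; have := mle_mdeg pm => //.
by move=> /leq_trans; apply.
Qed.

Definition mono x m : K := \prod_i x i ^+ m i.

Lemma monoD x p q : mono x (madd p q) = mono x p * mono x q.
Proof. by rewrite /mono -big_split; apply: eq_bigr => i _; rewrite ffunE exprD. Qed.

Lemma mono_mvar x (i : 'I_r) : mono x (mvar i) = x i.
Proof.
rewrite /mono (bigD1 i) //= ffunE eqxx expr1 big1 ?mulr1 // => j /negbTE ji.
by rewrite ffunE ji expr0.
Qed.

(** The value at the point x of the homogeneous component of degree d: products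
    of power series become convolutions, and the powers of the generic ad A
    become powers of one endomorphism. *)
Definition ev d x (V : lmodType K) (f : pser r V) : V :=
  \sum_(m <- mbox d | mdeg m == d) mono x m *: f m.

Lemma evE D d x (V : lmodType K) (f : pser r V) : (d <= D)%N ->
  ev d x f = \sum_(m <- mbox D | mdeg m == d) mono x m *: f m.
Proof.
move=> dD; apply: big_mbox => m _ /eqP md; rewrite md eqxx andbT;
by apply: mdeg_mbox; rewrite md.
Qed.

Lemma eq_ev d x (V : lmodType K) (f g : pser r V) :
  (forall m, mdeg m = d -> f m = g m) -> ev d x f = ev d x g.
Proof. by move=> fg; apply: eq_bigr => m /eqP md; rewrite fg. Qed.

Lemma ev0 d x (V : lmodType K) (f : pser r V) :
  (forall m, mdeg m = d -> f m = 0) -> ev d x f = 0.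
Proof. by move=> f0; apply: big1 => m /eqP md; rewrite f0 // scaler0. Qed.

Lemma evD d x (V : lmodType K) (f g : pser r V) :
  ev d x (fun m => f m + g m) = ev d x f + ev d x g.
Proof. by rewrite -big_split; apply: eq_bigr => m _; rewrite scalerDr. Qed.

Lemma evZ d x (V : lmodType K) (f : pser r V) a :
  ev d x (fun m => a *: f m) = a *: ev d x f.
Proof. by rewrite scaler_sumr; apply: eq_bigr => m _; rewrite !scalerA mulrC. Qed.

Lemma ev_sum d x (V : lmodType K) (I : Type) (s : seq I) (P : pred I) (f : I -> pser r V) :
  ev d x (fun m => \sum_(i <- s | P i) f i m) = \sum_(i <- s | P i) ev d x (f i).
Proof. by rewrite exchange_big; apply: eq_bigr => m _; rewrite scaler_sumr. Qed.

Lemma ev_linear d x (V W : lmodType K) (L : V -> W) (f : pser r V) :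
  linear L -> ev d x (fun m => L (f m)) = L (ev d x f).
Proof.
move=> hL; rewrite /ev (linear_fun_sum _ _ _ hL); apply: eq_bigr => m _.
by rewrite (linear_fun_scale _ _ hL).
Qed.

Lemma mdeg_eq0 m : (mdeg m == 0%N) = (m == [ffun=> 0%N]).
Proof.
apply/eqP/eqP => [m0|->]; last by rewrite /mdeg big1 // => i _; rewrite ffunE.
by apply/ffunP => i; rewrite ffunE; apply/eqP; rewrite -leqn0 -m0 leq_mdeg.
Qed.

Lemma ev_deg0 x (V : lmodType K) (f : pser r V) : ev 0 x f = f [ffun=> 0%N].
Proof.
rewrite /ev (eq_bigl _ _ mdeg_eq0) -big_filter.
rewrite (@perm_big _ _ _ _ _ [:: [ffun=> 0%N] : mindex r]).
  rewrite big_seq1 /mono big1 ?scale1r // => i _; by rewrite ffunE expr0.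
apply: uniq_perm; rewrite ?filter_uniq ?mbox_uniq // => m; rewrite mem_filter inE.
by case: eqP => //= ->; apply: mdeg_mbox; rewrite leqn0 mdeg_eq0.
Qed.

(** Bilinearity of a bare function, for operations such as the pairing of two
    brackets that carry no bilinear structure of their own. *)
Definition bilin (U V W : lmodType K) (op : U -> V -> W) :=
  (forall v, linear (op^~ v)) /\ (forall u, linear (op u)).

Lemma bilin_sum (U V W : lmodType K) (op : U -> V -> W) (I J : Type)
  (s : seq I) (t : seq J) (P : pred I) (Q : pred J) a b (F : I -> U) (G : J -> V) :
  bilin op ->
  op (\sum_(i <- s | P i) a i *: F i) (\sum_(j <- t | Q j) b j *: G j) =
  \sum_(i <- s | P i) \sum_(j <- t | Q j) (a i * b j) *: op (F i) (G j).
Proof.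
move=> [hl hr]; rewrite (linear_fun_sum _ _ _ (hl _)); apply: eq_bigr => i _.
rewrite (linear_fun_scale _ _ (hl _)) (linear_fun_sum _ _ _ (hr _)) scaler_sumr.
by apply: eq_bigr => j _; rewrite (linear_fun_scale _ _ (hr _)) scalerA.
Qed.

Lemma ev_psmul d x (U V W : lmodType K) (op : U -> V -> W)
    (f : pser r U) (g : pser r V) : bilin op ->
  ev d x (psmul op f g) = \sum_(k < d.+1) op (ev k x f) (ev (d - k) x g).
Proof.
move=> hop; transitivity (\sum_(p <- mbox d | (mdeg p < d.+1)%N)
    \sum_(q <- mbox d | mdeg q == (d - mdeg p)%N)
       (mono x p * mono x q) *: op (f p) (g q)).
  transitivity (\sum_(m <- mbox d | mdeg m == d) \sum_(p <- mbox d | mle p m)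
      mono x m *: op (f p) (g (msub m p))).
    apply: eq_bigr => m /eqP md; rewrite (psmulE (D := d)) ?md // scaler_sumr //.
  rewrite (exchange_big_dep (fun p => mdeg p < d.+1)%N) /=; last first.
    by move=> m p /eqP <- /mle_mdeg.
  apply: eq_bigr => p pd; rewrite (@big_mbox_shift _ d d p _ (fun q => mdeg q == d - mdeg p)%N).
  - by apply: eq_bigr => q _; rewrite maddK monoD.
  - move=> m _ /andP[/eqP md pm]; rewrite pm /=.
    have e : mdeg (msub m p) = (d - mdeg p)%N by rewrite -md -{2}(msubK pm) mdegD addKn.
    by rewrite e eqxx andbT; apply: mdeg_mbox; rewrite e leq_subr.
  - move=> q _ /eqP qd; rewrite mleD andbT mdegD qd subnKC // eqxx andbT.
    by apply: mdeg_mbox; rewrite mdegD qd subnKC.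
transitivity (\sum_(k < d.+1) \sum_(p <- mbox d | mdeg p == k) \sum_(q <- mbox d | mdeg q == (d - k)%N)
    (mono x p * mono x q) *: op (f p) (g q)); last first.
  apply: eq_bigr => k _; rewrite -bilin_sum // -!evE ?leq_subr //.
  by rewrite -ltnS.
rewrite [RHS](exchange_big_dep predT) //= [LHS]big_mkcond /=.
apply: eq_bigr => p _.
under [in RHS]eq_bigl do rewrite eq_sym.
by rewrite (big_ord1_eq _ (fun k => \sum_(q <- mbox d | mdeg q == (d - k)%N)
  (mono x p * mono x q) *: op (f p) (g q))).
Qed.

Lemma ev_psmulX d x (V : lmodType K) k (f : pser r V) :
  ev d.+1 x (psmulX k f) = x k *: ev d x f.
Proof.
rewrite /ev (bigID (fun m => m k == 0%N)) /= big1 ?add0r; last first.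
  by move=> m /andP[_ mk]; rewrite /psmulX mk scaler0.
rewrite scaler_sumr (@big_mbox_shift _ d.+1 d (mvar k) _ (fun q => mdeg q == d)).
- apply: eq_bigr => q _; rewrite monoD mono_mvar /psmulX ffunE [mvar k k]ffunE eqxx.
  by rewrite maddK scalerA.
- move=> m _ /andP[/eqP md mk].
  have mv : mle (mvar k) m.
    apply/forallP => i; rewrite ffunE; case: eqP => // ->; by rewrite lt0n.
  have e : mdeg (msub m (mvar k)) = d.
    by apply: succn_inj; rewrite -md -[in RHS](msubK mv) mdegD mdeg_mvar.
  by rewrite mv e eqxx andbT; apply: mdeg_mbox; rewrite e.
- move=> q _ /eqP qd; have e : mdeg (madd (mvar k) q) = d.+1 by rewrite mdegD mdeg_mvar qd.
  by rewrite e eqxx ffunE [mvar k k]ffunE eqxx andbT; apply: mdeg_mbox; rewrite e.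
Qed.

Lemma ev0_psmulX x (V : lmodType K) k (f : pser r V) : ev 0 x (psmulX k f) = 0.
Proof. by rewrite ev_deg0 /psmulX ffunE. Qed.

Lemma poly_eq0_nat (P : {poly K}) : (forall n : nat, P.[n.+1%:R] = 0) -> P = 0.
Proof.
move=> h; apply/eqP/negPn/negP => P0.
have := max_poly_roots P0 (rs := [seq n.+1%:R | n <- iota 0 (size P)]).
rewrite size_map size_iota ltnn => H; suff : false by []; apply: H.
  by apply/allP => _ /mapP[n _ ->]; rewrite /root h.
rewrite map_inj_uniq ?iota_uniq // => m n /eqP.
by rewrite eqr_nat => /eqP [].
Qed.

Lemma sum_digits_inj (b n : nat) (u v : 'I_n -> nat) :
  (forall i, (u i < b)%N) -> (forall i, (v i < b)%N) ->
  (\sum_i u i * b ^ i = \sum_i v i * b ^ i)%N -> u =1 v.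
Proof.
elim: n u v => [|n ihn] u v hu hv; first by move=> _ [].
have b0 : (0 < b)%N by apply: leq_trans (hu ord0).
have shift (w : 'I_n.+1 -> nat) : (\sum_i w i * b ^ i =
    (\sum_(i < n) w (lift ord0 i) * b ^ i) * b + w ord0)%N.
  rewrite big_ord_recl expn0 muln1 addnC big_distrl /=; congr (_ + _)%N.
  by apply: eq_bigr => i _; rewrite /bump leq0n add1n expnSr mulnA.
rewrite !shift => e.
have e0 : u ord0 = v ord0.
  by move/(congr1 (modn^~ b)): e; rewrite !modnMDl !modn_small.
have e1 : (\sum_(i < n) u (lift ord0 i) * b ^ i = \sum_(i < n) v (lift ord0 i) * b ^ i)%N.
  by apply/eqP; move/eqP: e; rewrite e0 eqn_add2r eqn_pmul2r.
move=> i; case: (unliftP ord0 i) => [j|] -> //.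
exact: (ihn (fun j => u (lift ord0 j)) (fun j => v (lift ord0 j)) _ _ e1).
Qed.

(** A power series is determined by the values of its homogeneous components:
    substituting t ^ (d + 1) ^ i for x_i separates the monomials of degree d. *)
Lemma ev_eq0 (f : pser r K^o) : (forall d x, ev d x f = 0) -> forall m, f m = 0.
Proof.
move=> h m; set d := mdeg m.
(* kap p has the exponents of p as its digits in base d + 1. *)
pose kap p := (\sum_i p i * d.+1 ^ i)%N.
pose P : {poly K} := \sum_(p <- mbox d | mdeg p == d) (f p : K) *: 'X^(kap p).
have P0 : P = 0.
  apply: poly_eq0_nat => n; rewrite -[RHS](h d (fun i => n.+1%:R ^+ (d.+1 ^ i))).
  rewrite /P horner_sum; apply: eq_bigr => p _; rewrite hornerZ hornerXn mulrC.
  by congr (_ * _); rewrite /mono -prodrXr; apply: eq_bigr => i _; rewrite -exprM mulnC.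
have : P`_(kap m) = 0 by rewrite P0 coef0.
rewrite /P coef_sum -big_filter (bigD1_seq m) ?filter_uniq ?mbox_uniq //=; last first.
  by rewrite mem_filter eqxx mdeg_mbox.
rewrite coefZ coefXn eqxx mulr1 big_seq_cond big1 ?addr0 // => p.
rewrite mem_filter => /andP[/andP[/eqP pd pb] pm]; rewrite coefZ coefXn.
case: eqP => [e|_]; last by rewrite mulr0.
case/negP: pm; apply/eqP/ffunP => i; symmetry in e.
apply: (sum_digits_inj _ _ e) => j; rewrite ltnS.
  by rewrite -pd leq_mdeg.
exact: leq_mdeg.
Qed.

(** In the coefficient at m + e_i the factor m_i + 1 splits as p_i + q_i over
    the pairs p + q = m + e_i. The terms with p_i = 0 drop out of the first
    half, and the others are shifted by e_i; likewise for the second half. *)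
Lemma psderiv_psmul (U V W : lmodType K) (op : U -> V -> W) (i : 'I_r)
    (f : pser r U) (g : pser r V) m : bilin op ->
  psderiv i (psmul op f g) m = psmul op (psderiv i f) g m + psmul op f (psderiv i g) m.
Proof.
move=> [hl hr]; set d := mdeg m; set M := madd m (mvar i).
have Md : mdeg M = d.+1 by rewrite mdegD mdeg_mvar addn1.
have opl u v n : op (u *+ n) v = op u v *+ n by exact: (linear_funMn _ _ (hl v)).
have opr u v n : op u (v *+ n) = op u v *+ n by exact: (linear_funMn _ _ (hr u)).
have Mi : M i = (m i).+1 by rewrite /M !ffunE eqxx addn1.
rewrite /psderiv -/M -Mi (psmulE (D := d.+1)) ?Md // -sumrMnl.
rewrite (eq_bigr (fun p => op (f p *+ p i) (g (msub M p))
    + op (f p) (g (msub M p) *+ (msub M p) i))); last first.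
  move=> p /forallP /(_ i) pM; rewrite opl opr -mulrnDr; congr (_ *+ _).
  by rewrite [msub M p i]ffunE subnKC.
rewrite big_split /=; congr (_ + _).
  rewrite (bigID (fun p : mindex r => p i == 0%N)) /= big1 ?add0r; last first.
    by move=> p /andP[_ /eqP ->]; rewrite opl.
  rewrite [RHS](psmulE (D := d)) //.
  rewrite (@big_mbox_shift _ d.+1 d (mvar i) _ (fun q => mle q m)).
  - apply: eq_bigr => q _; rewrite [madd (mvar i) q]maddC.
    have -> : msub M (madd q (mvar i)) = msub m q.
      by apply/ffunP => j; rewrite !ffunE subnDr.
    by rewrite [madd q (mvar i) i]ffunE ffunE eqxx addn1.
  - move=> p _ /andP[/forallP pM pi0].
    have mv : mle (mvar i) p.
      by apply/forallP => j; rewrite ffunE; case: eqP => // ->; rewrite lt0n.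
    rewrite mv /=.
    have qm : mle (msub p (mvar i)) m.
      apply/forallP => j; rewrite ffunE leq_subLR addnC; have := pM j.
      by rewrite [M j]ffunE.
    by rewrite qm andbT; apply: mdeg_mbox; exact: mle_mdeg.
  - move=> q _ /forallP qm.
    have h1 : mle (madd (mvar i) q) M.
      by apply/forallP => j; rewrite maddC /M !ffunE leq_add2r.
    rewrite h1 ffunE [mvar i i]ffunE eqxx andbT; apply: mdeg_mbox.
    by rewrite -Md mle_mdeg.
rewrite (bigID (fun p => mle p m)) /= [X in _ + X]big1 ?addr0; last first.
  move=> p /andP[/forallP pM /negP pm]; suff -> : msub M p i = 0%N by rewrite opr.
  rewrite ffunE; apply/eqP; rewrite subn_eq0 leqNgt Mi ltnS; apply/negP => pi.
  apply: pm; apply/forallP => j; have := pM j; rewrite /M !ffunE.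
  by case: eqP => [->|_] //; rewrite addn0.
rewrite [RHS](psmulE (D := d)) //.
have MS p : mle p m -> mle p M.
  move=> /forallP pm; apply/forallP => j; apply: leq_trans (pm j) _.
  by rewrite ffunE leq_addr.
rewrite (@big_mbox _ d.+1 d _ (fun p => mle p m)).
- apply: eq_bigr => p pm; move/forallP: (pm) => pm'.
  have -> : msub M p = madd (msub m p) (mvar i).
    by apply/ffunP => j; rewrite !ffunE addnBAC.
  by rewrite [madd _ _ i]ffunE [mvar i i]ffunE eqxx addn1.
- move=> p _ /andP[_ pm]; rewrite pm andbT; apply: mdeg_mbox; exact: mle_mdeg.
- move=> p _ pm; rewrite pm MS // !andbT; apply: mdeg_mbox.
  by rewrite -Md mle_mdeg // MS.
Qed.

End Evaluation.

(** * Powers of a linear form with values in endomorphisms *)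

Section Powers.
Variables (r : nat) (K : numFieldType) (V : vectType K).
Implicit Types (x : 'I_r -> K) (A Y T : 'End(V)).

Lemma comp_lfun_bilin : bilin (fun f g : 'End(V) => (f \o g)%VF).
Proof.
split=> [g a f f'|f a g g'] /=; first by rewrite comp_lfunDl comp_lfunZl.
by rewrite comp_lfunDr comp_lfunZr.
Qed.

Definition lpow T k : 'End(V) := iter k (comp_lfun T) \1%VF.

(** The directional derivative at A along Y of the k-th power. *)
Fixpoint dpow A Y k : 'End(V) :=
  if k is k'.+1 then (Y \o lpow A k')%VF + (A \o dpow A Y k')%VF else 0.

Variable S : pser r 'End(V).
Hypothesis S1 : forall m, mdeg m != 1%N -> S m = 0.

Lemma ev_deg1 d x : ev d x S = if d == 1%N then ev 1 x S else 0.
Proof.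
case: eqP => [->//|/eqP d1]; apply: ev0 => m md; apply: S1; by rewrite md.
Qed.

Lemma ev_pspow d x k : ev d x (pspow S k) = if d == k then lpow (ev 1 x S) k else 0.
Proof.
elim: k d => [|k ihk] d.
  case: eqP => [->|/eqP d0].
    by rewrite ev_deg0 /pspow /= /psconst mdeg_eq0 eqxx.
  by apply: ev0 => m md; rewrite /pspow /= /psconst md (negbTE d0).
rewrite /pspow iterS -/(pspow S k) (ev_psmul _ _ _ _ comp_lfun_bilin).
under eq_bigr => j _ do rewrite ev_deg1 ihk.
case: d => [|d]; first by rewrite big_ord1 /= comp_lfun0l.
rewrite 2!big_ord_recl /= comp_lfun0l add0r big1 ?addr0 => [|j _]; last first.
  by rewrite comp_lfun0l.
by rewrite subn1 /= eqSS; case: eqP => // _; rewrite comp_lfun0r.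
Qed.

Lemma ev_psderiv_deg1 d x i :
  ev d x (psderiv i S) = if d == 0%N then S (mvar i) else 0.
Proof.
case: eqP => [->|/eqP d0].
  rewrite ev_deg0 /psderiv ffunE mulr1n; congr S.
  by apply/ffunP => j; rewrite !ffunE.
apply: ev0 => m md; rewrite /psderiv S1 ?mul0rn //.
by rewrite mdegD mdeg_mvar md addn1 eqSS.
Qed.

Lemma ev_psderiv_pspow d x i k : ev d x (psderiv i (pspow S k)) =
  if k == d.+1 then dpow (ev 1 x S) (S (mvar i)) k else 0.
Proof.
elim: k d => [|k ihk] d.
  apply: ev0 => m _; rewrite /psderiv /pspow /= /psconst mdegD mdeg_mvar addn1.
  by rewrite mul0rn.
rewrite (@eq_ev _ _ _ _ _ _ (fun m => psmul (fun f g : 'End(V) => (f \o g)%VF) (psderiv i S) (pspow S k) m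
  + psmul (fun f g : 'End(V) => (f \o g)%VF) S (psderiv i (pspow S k)) m)); last first.
  by move=> m _; exact: (psderiv_psmul _ _ _ _ comp_lfun_bilin).
rewrite evD !(ev_psmul _ _ _ _ comp_lfun_bilin).
under eq_bigr => j _ do rewrite ev_psderiv_deg1 ev_pspow.
rewrite big_ord_recl /= subn0 big1 ?addr0; last by move=> j _; rewrite comp_lfun0l.
under eq_bigr => j _ do rewrite ev_deg1 ihk.
rewrite eqSS [k == d]eq_sym.
case: d => [|d].
  rewrite big_ord1 /= comp_lfun0l addr0; case: eqP => [<-|_]; last by rewrite comp_lfun0r.
  by rewrite /= comp_lfun0r addr0.
rewrite 2!big_ord_recl /= comp_lfun0l add0r big1 ?addr0 => [|j _]; last first.
  by rewrite comp_lfun0l.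
rewrite subn1 /= [d.+1 == k]eq_sym; case: eqP => [->|_] //=.
by rewrite !comp_lfun0r addr0.
Qed.

Lemma ev_pssubst a d x : ev d x (pssubst a S) = a d *: lpow (ev 1 x S) d.
Proof.
rewrite (@eq_ev _ _ _ _ _ _ (fun m => \sum_(k < d.+1) a k *: pspow S k m)); last first.
  by move=> m <-.
rewrite ev_sum big_ord_recr /= evZ ev_pspow eqxx big1 ?add0r // => k _.
by rewrite evZ ev_pspow gtn_eqF ?scaler0.
Qed.

Lemma ev_psderiv_pssubst a d x i : ev d x (psderiv i (pssubst a S)) =
  a d.+1 *: dpow (ev 1 x S) (S (mvar i)) d.+1.
Proof.
rewrite (@eq_ev _ _ _ _ _ _ (fun m => \sum_(k < d.+2) a k *: psderiv i (pspow S k) m)); last first.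
  move=> m md; rewrite /psderiv /pssubst mdegD mdeg_mvar addn1 md -sumrMnl.
  by apply: eq_bigr => k _; rewrite scalerMnr.
rewrite ev_sum big_ord_recr evZ ev_psderiv_pspow eqxx big1 => [|k _].
  by rewrite [LHS]add0r.
by rewrite evZ ev_psderiv_pspow /= ltn_eqF ?scaler0.
Qed.

Lemma pssubstD a b m : pssubst (fun k => a k + b k) S m = pssubst a S m + pssubst b S m.
Proof. by rewrite -big_split; apply: eq_bigr => k _; rewrite scalerDl. Qed.

Lemma pssubstN a m : pssubst (fun k => - a k) S m = - pssubst a S m.
Proof. by rewrite -sumrN; apply: eq_bigr => k _; rewrite scaleNr. Qed.

Lemma pssubst_half m : pssubst (half K) S m = psconst (2^-1 *: \1%VF) m.
Proof.
rewrite /pssubst big_ord_recl big1 ?addr0 => [|k _]; last by rewrite scale0r.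
by rewrite /pspow /= /psconst; case: ifP; rewrite ?scaler0.
Qed.

Lemma lpowE T k v : lpow T k v = iter k T v.
Proof. by elim: k => [|k ihk]; rewrite /= ?id_lfunE // comp_lfunE ihk. Qed.

(** The factor Y in the middle of the word is the one that is differentiated;
    the predecessor of k makes the word have k letters. *)
Lemma dpowE A Y k v : dpow A Y k v = \sum_(j < k) iter j A (Y (iter (k.-1 - j) A v)).
Proof.
elim: k => [|k ihk]; first by rewrite big_ord0 zero_lfunE.
rewrite /= add_lfunE !comp_lfunE lpowE big_ord_recl /= subn0 ihk linear_sum.
congr (_ + _); apply: eq_bigr => j _; rewrite /bump leq0n add1n /=.
by rewrite -subn1 -subnDA add1n.
Qed.

End Powers.

(** * Pairing tensors with the invariant form *)

Section Pairing.
Variables (K : numFieldType) (g : vectType K).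
Variables (br : {bilinear g -> g -> g}) (form : {symmetric g}).
Hypothesis nondeg : nondegenerate form.
Implicit Types (u v w a b c : g) (S T : 'End(g)).

Lemma formC u v : form u v = form v u.
Proof. by rewrite hermC expr0 mul1r. Qed.

Lemma formZl k u v : form (k *: u) v = k * form u v.
Proof. exact: linearZl_LR. Qed.

Lemma formZr k u v : form u (k *: v) = k * form u v.
Proof. by rewrite formC formZl formC. Qed.

Lemma formDl u v w : form (u + v) w = form u w + form v w.
Proof. exact: linearDl. Qed.

Lemma formNl u v : form (- u) v = - form u v.
Proof. exact: linearNl. Qed.

Lemma bilin_form : bilin (form : g -> g -> K^o).
Proof. by split=> [v|u] k x y; rewrite ?linearDl ?linearDr /= ?formZl ?formZr. Qed.

Lemma form_nondeg u : (forall v, form u v = 0) -> u = 0.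
Proof.
move=> h; apply/eqP; rewrite -memv0 -(eqP nondeg); apply/mem_orthovP => v _.
exact: h.
Qed.

Lemma form_inj u v : (forall w, form u w = form v w) -> u = v.
Proof.
move=> h; apply/subr0_eq/form_nondeg => w.
by rewrite linearBl /= h subrr.
Qed.

(** The Gram matrix is invertible because a vector of its kernel gives a
    combination of X that is orthogonal to the span of X. *)
Lemma gram_dual k (X : k.-tuple g) : free X ->
  (forall u, u \in <<X>>%VS -> (forall v, v \in <<X>>%VS -> form u v = 0) -> u = 0) ->
  forall i j : 'I_k, form (dual_basis form X i) X`_j = (i == j)%:R.
Proof.
move=> fX nX i j.
have G1 : gram form X \in unitmx.
  rewrite -row_free_unit -kermx_eq0; apply/rowV0P => c /sub_kermxP cG.
  have : \sum_i c 0 i *: X`_i = 0.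
    apply: nX => [|v /coord_span ->].
      by apply: rpred_sum => l _; apply/rpredZ/memv_span/mem_nth; rewrite size_tuple.
    rewrite linear_sumr big1 //= => l _; rewrite formZr.
    have := congr1 (fun M : 'rV_k => M 0 l) cG; rewrite !mxE => e.
    rewrite linear_sumlz (_ : \sum_(i0 < k) _ = 0) ?mulr0 // -[RHS]e.
    by apply: eq_bigr => m _; rewrite /= formZl !mxE.
  move/freeP: fX => /(_ _) h0; move=> h1; apply/rowP => l.
  by rewrite mxE; exact: (h0 (fun m => c 0 m) h1 l).
rewrite /dual_basis linear_sumlz /=.
transitivity ((invmx (gram form X) *m gram form X) i j); last by rewrite mulVmx // mxE.
by rewrite mxE; apply: eq_bigr => l _; rewrite formZl [gram form X l j]mxE.
Qed.

Local Notation e := (vbasis {:g}).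
Local Notation I := 'I_(\dim {:g}).
Local Notation e' := (dual_basis form e).

Lemma e_expand v : v = \sum_(a : I) coord e a v *: e`_a.
Proof. by rewrite [LHS](coord_vbasis (memvf v)). Qed.

Lemma e_dual (i j : I) : form (e' i) e`_j = (i == j)%:R.
Proof.
apply: gram_dual; first exact: basis_free (vbasisP _).
move=> u _ h; apply: form_nondeg => v; apply: h.
by rewrite (span_basis (vbasisP _)) memvf.
Qed.

Lemma form_e' (i : I) v : form (e' i) v = coord e i v.
Proof.
rewrite [v in LHS]e_expand linear_sumr /= (bigD1 i) //= formZr e_dual eqxx mulr1.
by rewrite big1 ?addr0 // => j /negbTE ji; rewrite formZr e_dual eq_sym ji mulr0.
Qed.

Lemma e'_expand v : v = \sum_(i : I) form v e`_i *: e' i.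
Proof.
apply: form_inj => w; rewrite linear_sumlz /=.
rewrite [w in LHS]e_expand linear_sumr /=; apply: eq_bigr => i _.
by rewrite formZr formZl form_e' mulrC.
Qed.

Lemma lift2_bilin_tens2 (W : lmodType K) (F : g -> g -> W) u v :
  bilin F -> lift2 F (tens2 u v) = F u v.
Proof.
move=> hF; rewrite [u in RHS]e_expand [v in RHS]e_expand bilin_sum //.
by apply: eq_bigr => i _; apply: eq_bigr => j _; rewrite ffunE.
Qed.

Lemma lift2D (W : lmodType K) (F : g -> g -> W) s t :
  lift2 F (s + t) = lift2 F s + lift2 F t.
Proof.
rewrite -big_split; apply: eq_bigr => i _; rewrite -big_split; apply: eq_bigr => j _.
by rewrite ffunE scalerDl.
Qed.

Lemma lift2Z (W : lmodType K) (F : g -> g -> W) k t :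
  lift2 F (k *: t) = k *: lift2 F t.
Proof.
rewrite scaler_sumr; apply: eq_bigr => i _; rewrite scaler_sumr; apply: eq_bigr => j _.
by rewrite ffunE scalerA.
Qed.

Lemma lift2_linear (W : lmodType K) (F : g -> g -> W) : linear (lift2 F).
Proof. by move=> k s t; rewrite lift2D lift2Z. Qed.

Lemma linear_lift2 (V W : lmodType K) (L : V -> W) (F : g -> g -> V) t : linear L ->
  L (lift2 F t) = lift2 (fun u v => L (F u v)) t.
Proof.
move=> hL; rewrite (linear_fun_sum _ _ _ hL); apply: eq_bigr => i _.
by rewrite (linear_fun_sum _ _ _ hL); apply: eq_bigr => j _; rewrite linear_fun_scale.
Qed.

Lemma lift2_tensor_of_End (W : lmodType K) (F : g -> g -> W) S : bilin F ->
  lift2 F (tensor_of_End form S) = \sum_(i : I) F (e' i) (S e`_i).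
Proof.
move=> hF; rewrite (linear_fun_sum _ _ _ (lift2_linear F)); apply: eq_bigr => i _.
exact: lift2_bilin_tens2.
Qed.

(** The pairing of a tensor with u (x) v. By nondegeneracy these pairings
    determine the tensor, and an endomorphism S becomes the form (S u, v). *)
Definition pair2 (t : tensor2 g) u v : K^o :=
  lift2 (fun a b => form a u * form b v : K^o) t.

Lemma pair2_linear u v : linear (fun t => pair2 t u v).
Proof. exact: lift2_linear. Qed.

Lemma bilin_pair2 u v : bilin (fun a b => form a u * form b v : K^o).
Proof.
split=> [b|a] k x y; rewrite linearDl /= formZl.
  by rewrite mulrDl -mulrA.
by rewrite mulrDr mulrCA.
Qed.

Lemma pair2_tens2 a b u v : pair2 (tens2 a b) u v = form a u * form b v.
Proof. exact/lift2_bilin_tens2/bilin_pair2. Qed.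

Lemma pair2_eq0 t : (forall u v, pair2 t u v = 0) -> t = 0.
Proof.
move=> h; apply/ffunP => -[i j]; rewrite ffunE -[RHS](h (e' i) (e' j)) /pair2 /lift2.
rewrite (bigD1 i) //= [X in _ + X]big1 ?addr0; last first.
  move=> i' /negbTE ii; apply: big1 => j' _.
  by rewrite [form e`_i' _]formC e_dual eq_sym ii mul0r scaler0.
rewrite (bigD1 j) //= big1 ?addr0; last first.
  by move=> j' /negbTE jj; rewrite [form e`_j' _]formC e_dual eq_sym jj mulr0 scaler0.
by rewrite formC e_dual [form e`_j _]formC e_dual !eqxx mulr1 [RHS]mulr1.
Qed.

Lemma form_sum_dual u (F : g -> K) : linear (F : g -> K^o) ->
  \sum_(i : I) form (e' i) u * F e`_i = F u.
Proof.
move=> hF; rewrite [u in RHS]e_expand (linear_fun_sum (W := K^o) _ _ _ hF).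
by apply: eq_bigr => i _; rewrite (linear_fun_scale (W := K^o) _ _ hF) form_e'.
Qed.

Lemma pair2_tensor_of_End S u v : pair2 (tensor_of_End form S) u v = form (S u) v.
Proof.
rewrite /pair2 lift2_tensor_of_End; last exact: bilin_pair2.
apply: (form_sum_dual u (F := fun w => form (S w) v)) => // k x y.
by rewrite linearP linearDl /= formZl.
Qed.

Lemma tensor_of_End_linear : linear (tensor_of_End form).
Proof.
move=> k S T; rewrite /tensor_of_End scaler_sumr -big_split.
apply: eq_bigr => i _; apply/ffunP => -[a b]; rewrite !ffunE /=.
by rewrite add_lfunE scale_lfunE linearP /= mulrDr mulrCA.
Qed.

Lemma pair2_flip t u v : pair2 (flip t) u v = pair2 t v u.
Proof.
rewrite /flip (linear_lift2 _ _ (pair2_linear u v)).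
apply: eq_bigr => i _; apply: eq_bigr => j _.
by rewrite pair2_tens2 mulrC.
Qed.

Hypothesis inv : invariant_form br form.
Hypothesis lie : is_lie_bracket br.

Lemma brC u v : br u v = - br v u.
Proof.
apply/eqP; rewrite -addr_eq0; have := lie.1 (u + v).
by rewrite linearDl /= !linearDr /= !lie.1 add0r addr0 => ->.
Qed.

Lemma form_br_skew y u v : form (br y u) v = - form u (br y v).
Proof. by rewrite brC linearNl /= inv. Qed.

Lemma form_br_cycle u v w : form (br u v) w = form (br v w) u.
Proof. by rewrite inv formC. Qed.

Lemma br_ad y z u : br (br y z) u = br y (br z u) - br z (br y u).
Proof.
have := lie.2 y z u; rewrite [br u (br y z)]brC [br u y]brC linearNr /= => h.
by apply/eqP; rewrite eq_sym -subr_eq0 h.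
Qed.

Lemma eq_lift2 (W : lmodType K) (F G : g -> g -> W) t :
  (forall a b, F a b = G a b) -> lift2 F t = lift2 G t.
Proof. by move=> FG; apply: eq_bigr => i _; apply: eq_bigr => j _; rewrite FG. Qed.

Lemma lift2_add_fun (W : lmodType K) (F G : g -> g -> W) t :
  lift2 (fun a b => F a b + G a b) t = lift2 F t + lift2 G t.
Proof.
rewrite -big_split; apply: eq_bigr => i _; rewrite -big_split; apply: eq_bigr => j _.
by rewrite scalerDr.
Qed.

Lemma lift2_scale_fun (W : lmodType K) (F : g -> g -> W) k t :
  lift2 (fun a b => k *: F a b) t = k *: lift2 F t.
Proof.
rewrite scaler_sumr; apply: eq_bigr => i _; rewrite scaler_sumr; apply: eq_bigr => j _.
by rewrite !scalerA mulrC.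
Qed.

Lemma pair2_ad2 y t u v :
  pair2 (ad2 br y t) u v = - (pair2 t (br y u) v + pair2 t u (br y v)).
Proof.
rewrite /ad2 (linear_lift2 _ _ (pair2_linear u v)) -scaleN1r -lift2_add_fun.
rewrite -lift2_scale_fun; apply: eq_lift2 => a b.
have /= := pair2_linear u v 1 (tens2 (br y a) b) (tens2 a (br y b)).
rewrite !scale1r => ->; rewrite !pair2_tens2 scaleN1r !form_br_skew.
by rewrite mulNr mulrN opprD.
Qed.

Definition pair3 (t : tensor3 g) u v w : K^o :=
  lift3 (fun a b c => form a u * form b v * form c w : K^o) t.

Lemma pair3_linear u v w : linear (fun t => pair3 t u v w).
Proof.
move=> k s t; rewrite /pair3 /lift3 scaler_sumr -big_split; apply: eq_bigr => i _.
rewrite scaler_sumr -big_split; apply: eq_bigr => j _.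
rewrite scaler_sumr -big_split; apply: eq_bigr => l _.
by rewrite !ffunE /GRing.scale /=; ring.
Qed.

Lemma pair3D s t u v w : pair3 (s + t) u v w = pair3 s u v w + pair3 t u v w.
Proof. by have := pair3_linear u v w 1 s t; rewrite !scale1r. Qed.

Lemma linear_lift3 (V W : lmodType K) (L : V -> W) (F : g -> g -> g -> V) t : linear L ->
  L (lift3 F t) = lift3 (fun u v w => L (F u v w)) t.
Proof.
move=> hL; rewrite (linear_fun_sum _ _ _ hL); apply: eq_bigr => i _.
rewrite (linear_fun_sum _ _ _ hL); apply: eq_bigr => j _.
by rewrite (linear_fun_sum _ _ _ hL); apply: eq_bigr => l _; rewrite linear_fun_scale.
Qed.

Lemma form_coord u v : form u v = \sum_(i : I) coord e i u * form e`_i v.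
Proof.
rewrite [u in LHS]e_expand linear_sumlz /=; apply: eq_bigr => i _.
by rewrite formZl.
Qed.

Lemma pair3_tens3 a b c u v w :
  pair3 (tens3 a b c) u v w = form a u * form b v * form c w.
Proof.
rewrite [form a u]form_coord [form b v]form_coord [form c w]form_coord.
rewrite -mulrA mulr_suml; apply: eq_bigr => i _.
rewrite mulr_suml mulr_sumr; apply: eq_bigr => j _.
rewrite mulr_sumr mulr_sumr; apply: eq_bigr => l _.
by rewrite ffunE /= /GRing.scale /=; ring.
Qed.

Lemma pair3_eq0 t : (forall u v w, pair3 t u v w = 0) -> t = 0.
Proof.
move=> h; apply/ffunP => -[[i j] l]; rewrite ffunE -[RHS](h (e' i) (e' j) (e' l)).
rewrite /pair3 /lift3.
rewrite (bigD1 i) //= [X in _ + X]big1 ?addr0; last first.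
  move=> i' /negbTE ii; apply: big1 => j' _; apply: big1 => l' _.
  by rewrite [form e`_i' _]formC e_dual eq_sym ii !mul0r scaler0.
rewrite (bigD1 j) //= [X in _ + X]big1 ?addr0; last first.
  move=> j' /negbTE jj; apply: big1 => l' _.
  by rewrite [form e`_j' _]formC e_dual eq_sym jj mulr0 mul0r scaler0.
rewrite (bigD1 l) //= [X in _ + X]big1 ?addr0; last first.
  by move=> l' /negbTE ll; rewrite [form e`_l' _]formC e_dual eq_sym ll mulr0 scaler0.
by rewrite ![form e`__ _]formC !e_dual !eqxx !mulr1 [RHS]mulr1.
Qed.

Lemma pair3_Alt t u v w :
  pair3 (Alt t) u v w = pair3 t u v w - pair3 t v u w + pair3 t w u v.
Proof.
rewrite /Alt pair3D -scaleN1r pair3D.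
rewrite (linear_fun_scale _ _ (pair3_linear u v w)) scaleN1r.
rewrite !(linear_lift3 _ _ (pair3_linear u v w)); congr (_ - _ + _).
  apply: eq_bigr => i _; apply: eq_bigr => j _; apply: eq_bigr => l _.
  by rewrite pair3_tens3; congr (_ *: _); ring.
apply: eq_bigr => i _; apply: eq_bigr => j _; apply: eq_bigr => l _.
by rewrite pair3_tens3; congr (_ *: _); ring.
Qed.

Lemma pair3_lift2_tens3 a t u v w :
  pair3 (lift2 (tens3 a) t) u v w = form a u * pair2 t v w.
Proof.
rewrite (linear_lift2 _ _ (pair3_linear u v w)) -[RHS]lift2_scale_fun.
by apply: eq_lift2 => b c; rewrite pair3_tens3 -mulrA.
Qed.

Lemma lift2_tensor_prod (f h : g -> K) S : linear (f : g -> K^o) -> linear (h : g -> K^o) ->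
  lift2 (fun c d => f c * h d : K^o) (tensor_of_End form S)
  = \sum_(i : I) f (e' i) * h (S e`_i).
Proof.
move=> hf hh; apply: (lift2_tensor_of_End (W := K^o) (F := fun c d => f c * h d : K^o)).
split=> [v|u] k x y; first by rewrite hf mulrDl -mulrA.
by rewrite hh mulrDr mulrCA.
Qed.

Lemma form_sum_dual_adj S S' w (F : g -> K) : (forall u v, form (S u) v = form u (S' v)) ->
  linear (F : g -> K^o) ->
  \sum_(i : I) F (e' i) * form (S e`_i) w = F (S' w).
Proof.
move=> hS hF; rewrite [S' w in RHS]e'_expand (linear_fun_sum (W := K^o) _ _ _ hF).
apply: eq_bigr => i _; rewrite (linear_fun_scale (W := K^o) _ _ hF) hS formC.
by rewrite mulrC.
Qed.

Lemma linear_form_br1 v w : linear (fun u => form (br u v) w : K^o).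
Proof. by move=> k x y; rewrite linearDl /= linearZl_LR linearDl /= formZl. Qed.

Lemma linear_form_br2 v w : linear (fun u => form (br v u) w : K^o).
Proof. by move=> k x y; rewrite linearDr /= linearZr_LR linearDl /= formZl. Qed.

Lemma linear_form1 v : linear (fun u => form u v : K^o).
Proof. by move=> k x y; rewrite linearDl /= formZl. Qed.

(** Each of the three brackets is contracted with one basis vector of r and
    one of s. When the dual vector e^i is the one that remains in the bracket,
    it collects to the adjoint S' of S, otherwise to S itself. *)
Lemma pair3_CYB2 S S' T T' a b c :
  (forall u v, form (S u) v = form u (S' v)) ->
  (forall u v, form (T u) v = form u (T' v)) ->
  pair3 (CYB2 br (tensor_of_End form S) (tensor_of_End form T)) a b c =
  form (br (S' b) (T' c)) a + form (br (S a) (T' c)) b + form (br (S a) (T b)) c.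
Proof.
move=> hS hT; rewrite /CYB2 (linear_lift2 _ _ (pair3_linear a b c)).
transitivity (lift2 (fun x y => form (br x (T' c)) a * form y b
    + form x a * form (br y (T' c)) b + form x a * form (br y (T b)) c : K^o)
    (tensor_of_End form S)).
  apply: eq_lift2 => x y; rewrite (linear_lift2 _ _ (pair3_linear a b c)).
  transitivity (lift2 (fun z t => form y b *: (form (br x z) a * form t c : K^o)
     + form x a *: (form (br y z) b * form t c : K^o)
     + form x a *: (form z b * form (br y t) c : K^o) : K^o) (tensor_of_End form T)).
    apply: eq_lift2 => z t; rewrite !pair3D !pair3_tens3 /GRing.scale /=; ring.
  rewrite !lift2_add_fun !lift2_scale_fun.
  rewrite !lift2_tensor_prod; [|exact: linear_form1|exact: linear_form_br2
    |exact: linear_form_br2|exact: linear_form1|exact: linear_form_br2|exact: linear_form1].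
  rewrite (form_sum_dual_adj _ hT (linear_form_br2 _ _)).
  rewrite (form_sum_dual_adj _ hT (linear_form_br2 _ _)).
  rewrite (form_sum_dual b (F := fun t => form (br y (T t)) c)).
    by rewrite [_ *: _]mulrC.
  by move=> k u v; rewrite linearP linear_form_br2.
rewrite !lift2_add_fun !lift2_tensor_prod;
  [|exact: linear_form1|exact: linear_form_br1|exact: linear_form1|exact: linear_form_br1
   |exact: linear_form_br1|exact: linear_form1].
rewrite (form_sum_dual_adj _ hS (linear_form_br1 _ _)).
rewrite (form_sum_dual a (F := fun t => form (br (S t) (T' c)) b)); last first.
  by move=> k u v; rewrite linearP linear_form_br1.
rewrite (form_sum_dual a (F := fun t => form (br (S t) (T b)) c)) //.
by move=> k u v; rewrite linearP linear_form_br1.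
Qed.

Lemma pair2_linearl t v : linear (fun u => pair2 t u v).
Proof.
move=> k x y; rewrite /pair2 -[X in _ = X + _]lift2_scale_fun -lift2_add_fun; apply: eq_lift2 => a b.
rewrite [form a (_ + _)]formC formDl formZl ![form _ a]formC /GRing.scale /=; ring.
Qed.

Lemma pair3_linear1 t v w : linear (fun u => pair3 t u v w).
Proof.
move=> k x y; rewrite /pair3 /lift3 scaler_sumr -big_split; apply: eq_bigr => i _.
rewrite scaler_sumr -big_split; apply: eq_bigr => j _.
rewrite scaler_sumr -big_split; apply: eq_bigr => l _.
by rewrite [form _ (_ + _)]formC formDl formZl ![form _ e`_i]formC /GRing.scale /=; ring.
Qed.

Lemma pair3_linear2 t u w : linear (fun v => pair3 t u v w).
Proof.
move=> k x y; rewrite /pair3 /lift3 scaler_sumr -big_split; apply: eq_bigr => i _.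
rewrite scaler_sumr -big_split; apply: eq_bigr => j _.
rewrite scaler_sumr -big_split; apply: eq_bigr => l _.
by rewrite [form _ (_ + _)]formC formDl formZl ![form _ e`_j]formC /GRing.scale /=; ring.
Qed.

Lemma pair3_linear3 t u v : linear (fun w => pair3 t u v w).
Proof.
move=> k x y; rewrite /pair3 /lift3 scaler_sumr -big_split; apply: eq_bigr => i _.
rewrite scaler_sumr -big_split; apply: eq_bigr => j _.
rewrite scaler_sumr -big_split; apply: eq_bigr => l _.
by rewrite [form _ (_ + _)]formC formDl formZl ![form _ e`_l]formC /GRing.scale /=; ring.
Qed.

End Pairing.

(** * The trilinear identity at one point *)

Section TrilinearIdentity.
Variables (K : numFieldType) (g : vectType K).
Variables (br : {bilinear g -> g -> g}) (form : {symmetric g}).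
Hypothesis inv : invariant_form br form.
Hypothesis lie : is_lie_bracket br.
Variables (y a b c : g).
Local Notation D := (br y).

Lemma br_derivation u v : D (br u v) = br (D u) v + br u (D v).
Proof. by rewrite (br_ad lie) subrK. Qed.

Lemma form_iter_skew p u v : form (iter p D u) v = (-1) ^+ p * form u (iter p D v).
Proof.
elim: p v => [|p ihp] v; first by rewrite expr0 mul1r.
by rewrite iterS (form_br_skew inv lie) ihp -iterSr exprS mulN1r mulNr.
Qed.

Definition tri p q s : K := form (br (iter p D b) (iter q D c)) (iter s D a).

(** Invariance of the trilinear form ([u, v], w) under y: the three variables
    s2, s3, s1 of the functional equation act with sum 0. *)
Lemma tri_rel p q s : tri p q s.+1 = - tri p.+1 q s - tri p q.+1 s.
Proof.
rewrite /tri !iterS -opprD -formDl -br_derivation.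
by rewrite (form_br_skew inv lie y) opprK.
Qed.

Local Notation Gam := (- 'X - 1 : {poly K}).

(** The linear functional with alpha ^ p |-> tri p (d - p) 0. It turns a
    polynomial identity into an identity for the trilinear form: the operators
    ad y on b, c, a stand for alpha = 'X, beta = 1 and gamma = - 'X - 1. *)
Definition lam d (P : {poly K}) : K := \sum_(p < d.+1) P`_p * tri p (d - p) 0.

Lemma lamD d P Q : lam d (P + Q) = lam d P + lam d Q.
Proof. by rewrite -big_split; apply: eq_bigr => p _; rewrite coefD mulrDl. Qed.

Lemma lamZ d k P : lam d (k *: P) = k * lam d P.
Proof. by rewrite mulr_sumr; apply: eq_bigr => p _; rewrite coefZ mulrA. Qed.

Lemma lamN d P : lam d (- P) = - lam d P.
Proof. by rewrite -scaleN1r lamZ mulN1r. Qed.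

Lemma lam0 d : lam d 0 = 0.
Proof. by apply: big1 => p _; rewrite coef0 mul0r. Qed.

Lemma lam_sum d n (k : nat -> K) (P : nat -> {poly K}) :
  lam d (\sum_(p < n) k p *: P p) = \sum_(p < n) k p * lam d (P p).
Proof.
elim: n => [|n ihn]; first by rewrite !big_ord0 lam0.
by rewrite !big_ord_recr /= lamD lamZ ihn.
Qed.

Lemma lam_monomial d p s : (p + s <= d)%N ->
  lam d ('X^p * Gam ^+ s) = tri p (d - p - s) s.
Proof.
elim: s p => [|s ihs] p psd.
  rewrite expr0 mulr1 subn0 /lam.
  have pd : (p < d.+1)%N by rewrite ltnS -(addn0 p).
  rewrite (bigD1 (Ordinal pd)) //= coefXn eqxx mul1r big1 ?addr0 // => i.
  by rewrite -val_eqE /= coefXn => /negbTE ->; rewrite mul0r.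
have -> : 'X^p * Gam ^+ s.+1 = - ('X^(p.+1) * Gam ^+ s) - 'X^p * Gam ^+ s.
  by rewrite !exprS; ring.
rewrite lamD !lamN ihs ?addSnnS // ihs; last by rewrite (leq_trans _ psd) // leq_add2l.
rewrite tri_rel; congr (- tri _ _ _ - tri _ _ _).
  by lia.
by lia.
Qed.

(** With k and k' the coefficients of degree d + 1 of f_j and f_(-j), the
    right-hand side is minus the term of (f_j (u s) + f_(-j) (v s)) / (w s) in
    s ^ d; by oddness it is a divided difference, hence a derivative of a
    power of ad A. *)
Lemma geometric_quotient d (u v w k k' : K) : u + v = - w -> w != 0 ->
  k' * (-1) ^+ d.+1 = - k ->
  k * \sum_(p < d.+1) (-1) ^+ p * (v ^+ p * u ^+ (d - p))
  = - ((k * u ^+ d.+1 + k' * v ^+ d.+1) / w).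
Proof.
move=> uv w0 kk; have uv0 : u + v != 0 by rewrite uv oppr_eq0.
have -> : w = - (u + v) by rewrite uv opprK.
have -> : \sum_(p < d.+1) (-1) ^+ p * (v ^+ p * u ^+ (d - p))
   = (u ^+ d.+1 - (- v) ^+ d.+1) / (u + v).
  rewrite subrXX opprK mulrAC mulfV // mul1r; apply: eq_bigr => p _.
  by rewrite /= [(- v) ^+ _]exprNn; ring.
have hk : k = - (k' * (-1) ^+ d.+1) by rewrite kk opprK.
have s2 : (-1) ^+ d.+1 * (-1) ^+ d.+1 = 1 :> K.
  by rewrite -exprMn mulrNN mulr1 expr1n.
rewrite [(- v) ^+ _]exprNn; have -> : k' = - k * (-1) ^+ d.+1 by rewrite -kk -mulrA s2 mulr1.
transitivity ((k * u ^+ d.+1 - k * ((-1) ^+ d.+1 * v ^+ d.+1)) / (u + v)).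
  by field.
by rewrite invrN mulrN opprK; congr (_ / _); ring.
Qed.

Variables (ci cj ck : nat -> K) (di dj dk : K).
Local Notation h := (half K).
Hypothesis odd_i : di != 0 -> forall d, ck d * (-1) ^+ d = - cj d.
Hypothesis odd_j : dj != 0 -> forall d, ck d * (-1) ^+ d = - ci d.
Hypothesis odd_k : dk != 0 -> forall d, cj d * (-1) ^+ d = - ci d.
Hypothesis cidentity : forall al be ga d, ga + al + be = 0 ->
  al != 0 -> be != 0 -> ga != 0 ->
  let a1 := scale_coef ci ga in let a2 := scale_coef cj al in
  let a3 := scale_coef ck be in
  conv a1 a2 d + conv a2 a3 d + conv a3 a1 d + (if d is 0 then 4^-1 else 0) =
  di / ga * (a2 d.+1 + a3 d.+1) + dj / al * (a3 d.+1 + a1 d.+1)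
  + dk / be * (a1 d.+1 + a2 d.+1).

Lemma half_scale (a0 : nat -> K) z k :
  scale_coef a0 z k + h k = (a0 k + h k) * z ^+ k.
Proof. by rewrite /scale_coef; case: k => [|k]; rewrite mulrDl //= ?expr0 ?mulr1 ?mul0r. Qed.

Lemma halfN_scale (a0 : nat -> K) z k :
  - scale_coef a0 z k + h k = (- a0 k + h k) * z ^+ k.
Proof. by rewrite /scale_coef; case: k => [|k]; rewrite mulrDl mulNr //= ?expr0 ?mulr1 ?mul0r. Qed.

Definition trilinear_poly d : {poly K} :=
  (di * cj d.+1) *: (\sum_(p < d.+1) (-1) ^+ p *: ('X^(d - p) * Gam ^+ 0))
  + (dj * ci d.+1) *: (\sum_(p < d.+1) (-1) ^+ p *: ('X^0 * Gam ^+ (d - p)))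
  + (dk * ci d.+1) *: (\sum_(p < d.+1) (-1) ^+ p *: ('X^p * Gam ^+ (d - p)))
  + (\sum_(p < d.+1) ((- cj p + h p) * (- ck (d - p)%N + h (d - p)%N)) *: ('X^p * Gam ^+ 0)
  - \sum_(p < d.+1) ((ci p + h p) * (- ck (d - p)%N + h (d - p)%N)) *: ('X^0 * Gam ^+ p)
  + \sum_(p < d.+1) ((ci p + h p) * (cj (d - p)%N + h (d - p)%N)) *: ('X^(d - p) * Gam ^+ p)).

(** At a positive integer al all of al, 1 and - al - 1 are different from 0,
    so that the numerical identity applies, and infinitely many zeros suffice.
    *)
Lemma trilinear_poly_eq0 d : trilinear_poly d = 0.
Proof.
apply: poly_eq0_nat => n; set al : K := n.+1%:R.
have al0 : al != 0 by rewrite pnatr_eq0.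
pose ga : K := - al - 1.
have ga0 : ga != 0 by rewrite /ga -opprD oppr_eq0 /al natr1 pnatr_eq0.
have sum0 : ga + al + 1 = 0 by rewrite /ga; ring.
have hG : Gam.[al] = ga by rewrite !hornerE.
have hm p s : ('X^p * Gam ^+ s).[al] = al ^+ p * ga ^+ s.
  by rewrite hornerM hornerXn horner_exp hG.
rewrite /trilinear_poly !hornerD hornerN !hornerZ !horner_sum.
have geo (de k k' u v w : K) : u + v = - w -> w != 0 ->
    (de != 0 -> k' * (-1) ^+ d.+1 = - k) ->
    de * k * \sum_(p < d.+1) (-1) ^+ p * (v ^+ p * u ^+ (d - p))
    = - (de / w * (k * u ^+ d.+1 + k' * v ^+ d.+1)).
  have [->|d0] := eqVneq de 0; first by move=> _ _ _; rewrite !mul0r oppr0.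
  move=> uv w0 /(_ isT) kk; rewrite -mulrA (geometric_quotient uv w0 kk).
  by rewrite mulrN; congr (- _); ring.
have e1 := geo di (cj d.+1) (ck d.+1) al 1 ga _ ga0 (fun d0 => odd_i d0 _).
have e2 := geo dj (ci d.+1) (ck d.+1) ga 1 al _ al0 (fun d0 => odd_j d0 _).
have e3 := geo dk (ci d.+1) (cj d.+1) ga al 1 _ (oner_neq0 _) (fun d0 => odd_k d0 _).
have := cidentity d sum0 al0 (oner_neq0 _) ga0.
rewrite /= -conv_half_shift => eqc.
transitivity (
    (- (di / ga * (cj d.+1 * al ^+ d.+1 + ck d.+1 * 1 ^+ d.+1))
     - dj / al * (ci d.+1 * ga ^+ d.+1 + ck d.+1 * 1 ^+ d.+1)
     - dk / 1 * (ci d.+1 * ga ^+ d.+1 + cj d.+1 * al ^+ d.+1))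
    + (di / ga * (cj d.+1 * al ^+ d.+1 + ck d.+1 * 1 ^+ d.+1)
      + dj / al * (ck d.+1 * 1 ^+ d.+1 + ci d.+1 * ga ^+ d.+1)
      + dk / 1 * (ci d.+1 * ga ^+ d.+1 + cj d.+1 * al ^+ d.+1))); last by ring.
rewrite -eqc; congr (_ + _).
  rewrite -e1 -?e2 -?e3 //; try (by rewrite /ga; ring).
  congr (_ * _ + _ * _ + _ * _); apply: eq_bigr => p _;
    by rewrite hornerZ hm ?expr0 ?expr1n ?mul1r ?mulr1.
congr (_ - _ + _); apply: eq_bigr => p _.
- rewrite !halfN_scale hornerZ hm expr1n; ring.
- rewrite halfN_scale half_scale hornerZ hm expr1n; ring.
- rewrite !half_scale hornerZ hm; ring.
Qed.

(** The component of degree d of Alt (dr) + CYB (r) at the point y, paired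
    with a (x) b (x) c; di, dj, dk select the elements of l among a, b, c. *)
Definition trilinear_expr d : K :=
  di * cj d.+1 * (\sum_(p < d.+1) form (iter p D (br a (iter (d - p) D b))) c)
  - dj * ci d.+1 * (\sum_(p < d.+1) form (iter p D (br b (iter (d - p) D a))) c)
  + dk * ci d.+1 * (\sum_(p < d.+1) form (iter p D (br c (iter (d - p) D a))) b)
  + \sum_(p < d.+1)
     ((- cj p + h p) * (- ck (d - p)%N + h (d - p)%N)
        * form (br (iter p D b) (iter (d - p) D c)) a
      + (ci p + h p) * (- ck (d - p)%N + h (d - p)%N)
        * form (br (iter p D a) (iter (d - p) D c)) b
      + (ci p + h p) * (cj (d - p)%N + h (d - p)%N)
        * form (br (iter p D a) (iter (d - p) D b)) c).

Lemma trilinear_exprE d : trilinear_expr d = lam d (trilinear_poly d).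
Proof.
rewrite /trilinear_expr /trilinear_poly !lamD lamN !lamZ.
rewrite (lam_sum d d.+1 (fun p => (-1) ^+ p) (fun p => 'X^(d - p) * Gam ^+ 0)).
rewrite (lam_sum d d.+1 (fun p => (-1) ^+ p) (fun p => 'X^0 * Gam ^+ (d - p))).
rewrite (lam_sum d d.+1 (fun p => (-1) ^+ p) (fun p => 'X^p * Gam ^+ (d - p))).
rewrite (lam_sum d d.+1 (fun p => (- cj p + h p) * (- ck (d - p)%N + h (d - p)%N))
  (fun p => 'X^p * Gam ^+ 0)).
rewrite (lam_sum d d.+1 (fun p => (ci p + h p) * (- ck (d - p)%N + h (d - p)%N))
  (fun p => 'X^0 * Gam ^+ p)).
rewrite (lam_sum d d.+1 (fun p => (ci p + h p) * (cj (d - p)%N + h (d - p)%N))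
  (fun p => 'X^(d - p) * Gam ^+ p)).
rewrite !big_split /= -sumrN.
have le_p (p : 'I_d.+1) : (p <= d)%N by rewrite -ltnS.
congr (_ + _ + _ + (_ + _ + _)).
- congr (_ * _); apply: eq_bigr => p _; rewrite lam_monomial ?addn0 ?leq_subr //.
  by rewrite subn0 subKn // form_iter_skew /tri (form_br_cycle inv).
- rewrite -mulrN -sumrN; congr (_ * _); apply: eq_bigr => p _.
  rewrite lam_monomial ?add0n ?leq_subr // subn0 subKn // form_iter_skew /tri /=.
  by rewrite (form_br_skew inv lie) mulrN opprK formC.
- congr (_ * _); apply: eq_bigr => p _; rewrite lam_monomial ?subnKC // subnn.
  by rewrite form_iter_skew /tri /= (form_br_cycle inv) (form_br_cycle inv).
- apply: eq_bigr => p _; rewrite lam_monomial ?addn0 // subn0 //.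
- apply: eq_bigr => p _; rewrite lam_monomial ?add0n // subn0 /tri /=.
  by rewrite -mulrN (form_br_cycle inv) (brC lie) formNl.
apply: eq_bigr => p _; rewrite lam_monomial ?subnK // subKn // subnn /tri /=.
by rewrite (form_br_cycle inv).
Qed.

Lemma trilinear_identity d : trilinear_expr d = 0.
Proof. by rewrite trilinear_exprE trilinear_poly_eq0 lam0. Qed.

Lemma trilinear_expr_eq0 d : (forall p q s, tri p q s = 0) -> trilinear_expr d = 0.
Proof.
by move=> h; rewrite trilinear_exprE; apply: big1 => p _; rewrite h mulr0.
Qed.

End TrilinearIdentity.

(** * The grading defined by the automorphism *)

Section Grading.
Variables (R : realType) (g : vectType R[i]).
Local Notation C := R[i].
Variables (br : {bilinear g -> g -> g}) (form : {symmetric g}).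
Variables (B : 'End(g)) (n : nat).
Hypothesis hB : is_lie_automorphism br B.
Hypothesis hn : has_order B n.
Hypothesis hBform : forall x y, form (B x) (B y) = form x y.
Implicit Types (u v w a b c : g) (i j k : nat).

Local Notation z j := (cexp (angle R n j)).

Lemma order_gt0 : (0 < n)%N.
Proof. by case: hn. Qed.

Lemma zD i j : z (i + j) = z i * z j.
Proof. by rewrite angleD cexpD. Qed.

Lemma z_neq0 i : z i != 0.
Proof. exact: cexp_neq0. Qed.

Lemma zX i j : z (i * j) = z i ^+ j.
Proof. by rewrite cexp_angleE [in RHS]cexp_angleE exprM. Qed.

Lemma z_mod i : z (i %% n) = z i.
Proof.
rewrite [in RHS](divn_eq i n) zD [z (_ * n)]cexp_angle_dvd ?mul1r ?order_gt0 //.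
exact: dvdn_mull.
Qed.

Lemma z_neq1 i : ~~ (n %| i)%N -> z i != 1.
Proof.
move=> ni; rewrite -z_mod; apply: cexp_angle_neq1.
by rewrite ltn_pmod ?order_gt0 // lt0n andbT.
Qed.

Lemma mem_gj j v : (v \in gj B n j) = (B v == z j *: v).
Proof.
rewrite /gj /passmx.leigenspace memv_ker add_lfunE opp_lfunE scale_lfunE id_lfunE.
by rewrite subr_eq0.
Qed.

Lemma gjP j v : v \in gj B n j -> B v = z j *: v.
Proof. by rewrite mem_gj => /eqP. Qed.

Lemma gj_br i j u v : u \in gj B n i -> v \in gj B n j -> br u v \in gj B n (i + j).
Proof.
move=> /gjP hu /gjP hv; rewrite mem_gj hB.2 hu hv linearZl_LR linearZr_LR /=.
by rewrite scalerA zD.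
Qed.

(** B preserves the form and multiplies it by the character of i + j. *)
Lemma form_gj i j u v : u \in gj B n i -> v \in gj B n j -> ~~ (n %| i + j)%N ->
  form u v = 0.
Proof.
move=> /gjP hu /gjP hv /z_neq1 zij; apply/eqP.
have := hBform u v; rewrite hu hv formZl formZr mulrA -zD => /eqP.
rewrite -[X in _ == X]mul1r -subr_eq0 -mulrBl mulf_eq0 subr_eq0.
by rewrite (negbTE zij).
Qed.

Lemma iter_B_order v : iter n B v = v.
Proof. by case: hn => _ h _. Qed.

(** The projection onto g_j, by averaging over the powers of B. *)
Definition gproj j : 'End(g) :=
  n%:R^-1 *: \sum_(k < n) (z (j * k))^-1 *: lpow B k.

Lemma gprojE j v : gproj j v = n%:R^-1 *: \sum_(k < n) (z (j * k))^-1 *: iter k B v.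
Proof.
rewrite scale_lfunE sum_lfunE; congr (_ *: _); apply: eq_bigr => k _.
by rewrite scale_lfunE lpowE.
Qed.

Lemma gproj_mem j v : gproj j v \in gj B n j.
Proof.
rewrite mem_gj gprojE linearZ /= scalerA mulrC -scalerA; apply/eqP; congr (_ *: _).
rewrite linear_sum scaler_sumr /=.
(* Applying B shifts the summation index cyclically, as F n = F 0. *)
pose F k := z j *: ((z (j * k))^-1 *: iter k B v).
transitivity (\sum_(k < n) F k.+1).
  apply: eq_bigr => k _; rewrite /F linearZ /= scalerA; congr (_ *: _).
  by rewrite mulnS zD; field; rewrite !z_neq0.
have e : F n = F 0%N.
  by rewrite /F iter_B_order muln0 [z (j * n)]cexp_angle_dvd ?order_gt0 ?dvdn_mull // cexp_angle0.
have : \sum_(k < n.+1) F k = F 0%N + \sum_(k < n) F k.+1 by rewrite big_ord_recl.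
rewrite big_ord_recr /= e addrC => /addrI <-.
by apply: eq_bigr => k _; rewrite /F /=.
Qed.

Lemma sum_root_of_unity (w : C) : w != 1 -> w ^+ n = 1 -> \sum_(k < n) w ^+ k = 0.
Proof.
move=> w1 wn; have := subrX1 w n; rewrite wn subrr => /esym/eqP.
by rewrite mulf_eq0 subr_eq0 (negbTE w1) => /eqP.
Qed.

Lemma n_neq0 : (n%:R : C) != 0.
Proof. by rewrite pnatr_eq0 -lt0n order_gt0. Qed.

Lemma z_order k : z k ^+ n = 1.
Proof. by rewrite -zX cexp_angle_dvd ?order_gt0 // dvdn_mull. Qed.

Lemma sum_gproj v : \sum_(j < n) gproj j v = v.
Proof.
under eq_bigr => j _ do rewrite gprojE.
rewrite -scaler_sumr exchange_big /=.
have n0 := order_gt0.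
rewrite (bigD1 (Ordinal n0)) //= [X in _ *: (_ + X)]big1 ?addr0 => [|k k0].
  under eq_bigr => j _ do rewrite muln0 cexp_angle0 invr1 scale1r.
  by rewrite sumr_const card_ord /= -[v *+ n]scaler_nat scalerA mulVf ?scale1r // n_neq0.
rewrite -scaler_suml (_ : \sum_(i < n) _ = 0) ?scale0r //.
under eq_bigr => j _ do rewrite mulnC zX -exprVn.
apply: sum_root_of_unity; last by rewrite exprVn z_order invr1.
rewrite invr_eq1 z_neq1 //; apply/negP => /dvdn_leq; rewrite lt0n => /(_ k0).
by rewrite leqNgt ltn_ord.
Qed.

Lemma iter_gj j k v : v \in gj B n j -> iter k B v = z j ^+ k *: v.
Proof.
move=> hv; elim: k => [|k ihk]; first by rewrite expr0 scale1r.
by rewrite iterS ihk linearZ /= (gjP hv) scalerA exprSr.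
Qed.

Lemma gproj_gj j k v : (j < n)%N -> (k < n)%N -> v \in gj B n k ->
  gproj j v = if j == k then v else 0.
Proof.
move=> jn kn hv; rewrite gprojE.
under eq_bigr => l _ do rewrite (iter_gj _ hv) scalerA zX -exprVn -exprMn.
rewrite -scaler_suml scalerA; case: eqP => [->|/eqP jk].
  under eq_bigr => l _ do rewrite mulVf ?z_neq0 // expr1n.
  by rewrite sumr_const card_ord mulVf ?scale1r // n_neq0.
rewrite sum_root_of_unity ?mulr0 ?scale0r //; last first.
  by rewrite exprMn exprVn !z_order invr1 mulr1.
rewrite mulrC; apply/eqP => e.
have ejk : z j = z k by rewrite -[z j]mul1r -e divfK ?z_neq0.
wlog lt : j k jn kn jk ejk {hv e} / (j < k)%N.
  move=> W; case: (ltngtP j k) => [jk'|kj|]; [exact: (W j k)| |by move/eqP: jk].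
  by apply: (W k j) => //; rewrite eq_sym.
have /eqP[] : z (k - j) != 1.
  apply/z_neq1/negP => /dvdn_leq; rewrite subn_gt0 => /(_ lt).
  by rewrite leqNgt (leq_ltn_trans _ kn) // leq_subr.
by apply: (mulIf (z_neq0 j)); rewrite -zD subnK ?mul1r // ltnW.
Qed.

Lemma gj_ind (V : lmodType C) (F : g -> V) : linear F ->
  (forall j u, (j < n)%N -> u \in gj B n j -> F u = 0) -> forall u, F u = 0.
Proof.
move=> hF h u; rewrite -(sum_gproj u) (linear_fun_sum _ _ _ hF) big1 // => j _.
by apply: (h j) => //; exact: gproj_mem.
Qed.

Hypothesis nondeg : nondegenerate form.
Variables (r : nat) (X : r.-tuple g).
Hypothesis hX : basis_of (gj B n 0) X.

Local Notation xd := (dual_basis form X).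

Lemma span_X : <<X>>%VS = gj B n 0.
Proof. by apply/eqP; case/andP: hX. Qed.

(** The other g_j are orthogonal to g_0. *)
Lemma g0_nondeg u : u \in gj B n 0 -> (forall v, v \in gj B n 0 -> form u v = 0) -> u = 0.
Proof.
move=> u0 h; apply: (form_nondeg nondeg).
apply: (gj_ind (V := C^o) (F := fun v => form u v)).
  by move=> k x y; have := (bilin_form form).2 u k x y.
move=> j v jn vj; have [j0|j0] := eqVneq j 0%N; first by apply: h; rewrite -j0.
apply: (form_gj u0 vj); rewrite add0n; apply/negP => /dvdn_leq; rewrite lt0n => /(_ j0).
by rewrite leqNgt jn.
Qed.

Lemma X_mem (i : 'I_r) : X`_i \in gj B n 0.
Proof. by rewrite -span_X memv_span // mem_nth // size_tuple. Qed.

Lemma xd_mem (i : 'I_r) : xd i \in gj B n 0.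
Proof. by apply: rpred_sum => j _; apply: rpredZ; exact: X_mem. Qed.

Lemma xd_dual (i j : 'I_r) : form (xd i) X`_j = (i == j)%:R.
Proof.
apply: gram_dual; first exact: basis_free hX.
by rewrite span_X; exact: g0_nondeg.
Qed.

Lemma xd_expand v : v \in gj B n 0 -> v = \sum_(i < r) form v X`_i *: xd i.
Proof.
move=> hv; apply/subr0_eq/g0_nondeg.
  by apply: rpredB => //; apply: rpred_sum => i _; apply: rpredZ; exact: xd_mem.
rewrite -span_X => w /coord_span ->; rewrite linear_sumr big1 //= => j _.
rewrite formZr formDl formNl linear_sumlz /= (bigD1 j) //= formZl xd_dual eqxx mulr1.
rewrite big1 ?addr0 ?subrr ?mulr0 // => i /negbTE ij.
by rewrite formZl xd_dual ij mulr0.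
Qed.

(** The sum is the projection to g_0, the direction in which the leg x_k
    of the differential of r, paired with a, differentiates. *)
Lemma sum_xd i a : (i < n)%N -> a \in gj B n i ->
  \sum_(k < r) form X`_k a *: xd k = (i == 0%N)%:R *: a.
Proof.
move=> il ha; have [i0|i0] := eqVneq i 0%N.
  rewrite scale1r [RHS]xd_expand -?i0 //; by apply: eq_bigr => k _; rewrite formC.
rewrite scale0r big1 // => k _; rewrite (form_gj (X_mem k) ha) ?scale0r // add0n.
by apply/negP => /dvdn_leq; rewrite lt0n => /(_ i0); rewrite leqNgt il.
Qed.

(** * The r-matrix on the graded pieces *)

Hypothesis lie : is_lie_bracket br.
Hypothesis inv : invariant_form br form.

Local Notation cf j := (expansion0 (@f_ R n j)).
Local Notation S := (ad_generic br form X).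
Local Notation h := (half C).
Implicit Types (x : 'I_r -> C) (m : mindex r).

(** The element of l with coordinates x: the X_i are coordinates through the
    form, so that they go with the dual basis. *)
Definition point x : g := \sum_(i < r) x i *: xd i.

Lemma point_mem x : point x \in gj B n 0.
Proof. by apply: rpred_sum => i _; apply/rpredZ/xd_mem. Qed.

Lemma form_X_point x (i : 'I_r) : form X`_i (point x) = x i.
Proof.
rewrite formC linear_sumlz /= (bigD1 i) //= formZl xd_dual eqxx mulr1.
by rewrite big1 ?addr0 // => k /negbTE ki; rewrite formZl xd_dual ki mulr0.
Qed.

Lemma mvar_inj : injective (@mvar r).
Proof.
by move=> i j /ffunP /(_ i); rewrite !ffunE eqxx; case: eqP.
Qed.

Lemma ad_generic_deg1 m : mdeg m != 1%N -> S m = 0.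
Proof.
move=> m1; apply: big1 => i _; case: eqP => // mi.
by case/eqP: m1; rewrite mi mdeg_mvar.
Qed.

Lemma ad_generic_mvar (i : 'I_r) : S (mvar i) = ad br (xd i).
Proof.
rewrite /ad_generic (bigD1 i) //= eqxx big1 ?addr0 // => k ki.
by case: eqP => // /mvar_inj ik; rewrite ik eqxx in ki.
Qed.

Lemma adE y u : ad br y u = br y u.
Proof. by rewrite lfunE. Qed.

Lemma br_suml (I : Type) (s : seq I) (P : pred I) (F : I -> g) u :
  br (\sum_(i <- s | P i) F i) u = \sum_(i <- s | P i) br (F i) u.
Proof. exact: linear_sumlz. Qed.

Lemma ev_ad_generic x : ev 1 x S = ad br (point x).
Proof.
apply/lfunP => u; rewrite adE /point br_suml ev_sum sum_lfunE; apply: eq_bigr => i _.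
rewrite linearZl_LR /= /ev (bigID (fun m => m == mvar i)) /= addrC big1 ?add0r.
  rewrite (eq_bigl (fun m => m == mvar i)) => [|m]; last first.
    by case: (m =P mvar i) => [->|_]; rewrite ?andbF // mdeg_mvar.
  rewrite -big_filter (@perm_big _ _ _ _ _ [:: mvar i]) => [|].
    by rewrite big_seq1 eqxx mono_mvar scale_lfunE adE.
  apply: uniq_perm; rewrite ?filter_uniq ?mbox_uniq // => m.
  rewrite mem_filter inE; case: eqP => // ->.
  by apply: mdeg_mbox; rewrite mdeg_mvar.
by move=> m /andP[_ /negbTE ->]; rewrite scaler0.
Qed.

Lemma iter_ad k y u : iter k (ad br y) u = iter k (br y) u.
Proof. by elim: k => //= k ->; rewrite adE. Qed.

Lemma ev_pssubst_ad (t : nat -> C) d x u :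
  ev d x (pssubst t S) u = t d *: iter d (br (point x)) u.
Proof.
rewrite (ev_pssubst ad_generic_deg1) scale_lfunE lpowE ev_ad_generic.
by rewrite iter_ad.
Qed.

Lemma dpow_adE y w d u :
  dpow (ad br y) (ad br w) d u
  = \sum_(p < d) iter p (br y) (br w (iter (d.-1 - p) (br y) u)).
Proof.
rewrite dpowE; apply: eq_bigr => p _; rewrite !iter_ad.
by rewrite (adE w).
Qed.

Lemma ev_psderiv_pssubst_ad (t : nat -> C) d x (i : 'I_r) u :
  ev d x (psderiv i (pssubst t S)) u = t d.+1 *:
    \sum_(p < d.+1) iter p (br (point x)) (br (xd i) (iter (d - p) (br (point x)) u)).
Proof.
rewrite (ev_psderiv_pssubst ad_generic_deg1) scale_lfunE ev_ad_generic.
by rewrite ad_generic_mvar dpow_adE.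
Qed.

(** The conditions that define rhohat are met by the sum of the f_j (ad A)
    composed with the projections onto g_j. *)
Lemma rhohatE m j u : (j < n)%N -> u \in gj B n j ->
  rhohat br form B n X m u = pssubst (cf j) S m u.
Proof.
move=> jn hu; rewrite /rhohat; case: xgetP => [T -> /(_ j jn u hu) //|].
move/(_ (\sum_(i < n) (pssubst (cf i) S m \o gproj i)%VF)) => H; case: H => i il v hv.
rewrite sum_lfunE (bigD1 (Ordinal il)) //= comp_lfunE (gproj_gj il il hv) eqxx.
rewrite big1 ?addr0 // => k ki; rewrite comp_lfunE (gproj_gj (ltn_ord k) il hv).
by rewrite -val_eqE /= in ki; rewrite (negbTE ki) linear0.
Qed.

(** The endomorphism whose tensor is r_B; rmat_adj is its adjoint for the
    form. *)
Definition rmat m : 'End(g) := psconst (2^-1 *: \1%VF) m + rhohat br form B n X m.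
Definition rmat_adj m : 'End(g) := psconst (2^-1 *: \1%VF) m - rhohat br form B n X m.

Lemma rmatE m j u : (j < n)%N -> u \in gj B n j ->
  rmat m u = pssubst (fun k => cf j k + h k) S m u.
Proof.
move=> jn hu; rewrite add_lfunE (rhohatE _ jn hu) pssubstD add_lfunE pssubst_half.
by rewrite addrC.
Qed.

Lemma rmat_adjE m j u : (j < n)%N -> u \in gj B n j ->
  rmat_adj m u = pssubst (fun k => - cf j k + h k) S m u.
Proof.
move=> jn hu; rewrite add_lfunE opp_lfunE (rhohatE _ jn hu) pssubstD add_lfunE.
by rewrite pssubstN opp_lfunE pssubst_half addrC.
Qed.

Lemma iter_point_mem d x j u : u \in gj B n j ->
  iter d (br (point x)) u \in gj B n j.
Proof.
move=> hu; elim: d => [|d ihd]; first exact: hu.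
by rewrite iterS; exact: (gj_br (point_mem x) ihd).
Qed.

Lemma linear_form_endo (T : 'End(g)) v : linear (fun u => form (T u) v : C^o).
Proof. by move=> k x y; rewrite linearP formDl formZl. Qed.

Lemma linear_form_endor (T : 'End(g)) u : linear (fun v => form u (T v) : C^o).
Proof. by move=> k x y; rewrite formC linearP formDl formZl !(formC _ u). Qed.

Lemma linear_form_eval u v : linear (fun T : 'End(g) => form (T u) v : C^o).
Proof. by move=> k x y; rewrite add_lfunE scale_lfunE formDl formZl. Qed.

Lemma ev_form_eval d x (f : pser r 'End(g)) u v :
  ev d x (fun m => form (f m u) v : C^o) = form (ev d x f u) v.
Proof. exact: (ev_linear d x f (linear_form_eval u v)). Qed.

Lemma ev_form_pssubst (t : nat -> C) d x u v :
  ev d x (fun m => form (pssubst t S m u) v : C^o)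
  = t d * form (iter d (br (point x)) u) v.
Proof. by rewrite (ev_form_eval d x (pssubst t S)) ev_pssubst_ad formZl. Qed.

(** ad A preserves each g_j. *)
Lemma pssubst_ad_orthogonal (t : nat -> C) m j k u v :
  u \in gj B n j -> v \in gj B n k -> ~~ (n %| j + k)%N ->
  form (pssubst t S m u) v = 0.
Proof.
move=> hu hv jk; move: m.
apply: (ev_eq0 (f := fun m => form (pssubst t S m u) v : C^o)) => d x.
by rewrite ev_form_pssubst (form_gj (iter_point_mem d x hu) hv jk) mulr0.
Qed.

Lemma pssubst_ad_skew (s t : nat -> C) m u v :
  (forall d, t d * (-1) ^+ d = - s d) ->
  form (pssubst s S m u) v = - form u (pssubst t S m v).
Proof.
move=> st; apply/eqP; rewrite -addr_eq0 [form u _]formC; apply/eqP; move: m.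
apply: (ev_eq0 (f := fun m => form (pssubst s S m u) v + form (pssubst t S m v) u : C^o)).
move=> d x; rewrite evD !ev_form_pssubst (form_iter_skew inv lie) [form _ u]formC.
have -> : s d = - (t d * (-1) ^+ d) by rewrite st opprK.
by rewrite mulrA -mulrDl mulNr -mulrA -expr2 sqrr_sign mulr1 addNr mul0r.
Qed.

(** ad A is skew, g_j pairs only with g_(-j), and f_(-j) (- s) = - f_j s. *)
Lemma rhohat_skew m u v :
  form (rhohat br form B n X m u) v = - form u (rhohat br form B n X m v).
Proof.
apply/eqP; rewrite -addr_eq0; apply/eqP; move: v.
apply: (gj_ind (V := C^o)
  (F := fun v => form (rhohat br form B n X m u) v + form u (rhohat br form B n X m v) : C^o)).
  move=> k x y; rewrite (linear_form_endor _ u) ((bilin_form form).2 _ k x y).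
  by rewrite scalerDr addrACA.
move=> k v kn hv; move: u.
apply: (gj_ind (V := C^o)
  (F := fun u => form (rhohat br form B n X m u) v + form u (rhohat br form B n X m v) : C^o)).
  move=> l x y; rewrite (linear_form_endo _ v) ((bilin_form form).1 _ l x y).
  by rewrite scalerDr addrACA.
move=> j u jn hu; rewrite (rhohatE _ jn hu) (rhohatE _ kn hv).
have [jk|jk] := boolP (n %| j + k)%N.
  have odd d : cf k d * (-1) ^+ d = - cf j d by exact: expansion0_f_opp.
  by rewrite (pssubst_ad_skew _ _ _ odd) addNr.
rewrite (pssubst_ad_orthogonal _ _ hu hv jk) add0r formC.
by rewrite addnC in jk; rewrite (pssubst_ad_orthogonal _ _ hv hu jk).
Qed.

Lemma rmat_adjP m u v : form (rmat m u) v = form u (rmat_adj m v).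
Proof.
rewrite /rmat /rmat_adj !add_lfunE opp_lfunE formDl rhohat_skew [in RHS]formC formDl formNl.
rewrite [form _ u in RHS]formC [form (rhohat _ _ _ _ _ _ _) u]formC; congr (_ + _).
rewrite /psconst; case: ifP => _; last by rewrite !zero_lfunE linear0l linear0r.
by rewrite !scale_lfunE !id_lfunE formZl formZr.
Qed.

Lemma r_BE m : r_B br form B n X m = tensor_of_End form (rmat m).
Proof.
rewrite /r_B /rho /rmat; set T := rhohat _ _ _ _ _ _.
have := tensor_of_End_linear form 1 (psconst (2^-1 *: \1%VF) m) T.
rewrite !scale1r => ->; congr (_ + _).
rewrite /psconst; case: ifP => _; last first.
  by rewrite (linear_fun0 (tensor_of_End_linear form)).
by rewrite (linear_fun_scale _ _ (tensor_of_End_linear form)).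
Qed.

(** The skew part cancels, and 1/2 + 1/2 = 1 corresponds to Omega. *)
Lemma r_B_symmetric_part m :
  r_B br form B n X m + flip (r_B br form B n X m) = psconst (Omega form) m.
Proof.
apply/eqP; rewrite -subr_eq0; apply/eqP; apply: (pair2_eq0 nondeg) => u v.
have hl := pair2_linear form u v.
have pD s t : pair2 form (s + t) u v = pair2 form s u v + pair2 form t u v.
  by have := hl 1 s t; rewrite !scale1r.
rewrite !r_BE 2!pD -scaleN1r (linear_fun_scale _ _ hl) pair2_flip.
rewrite !(pair2_tensor_of_End nondeg) [form (rmat m v) u]formC rmat_adjP -linearDr /=.
have -> : rmat_adj m v + rmat m v = psconst \1%VF m v.
  rewrite -add_lfunE /rmat /rmat_adj addrACA addNr addr0 /psconst.
  case: ifP => _; last by rewrite addr0.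
  rewrite -scalerDl (_ : 2^-1 + 2^-1 = 1 :> C) ?scale1r //; by field.
rewrite /psconst; case: ifP => _.
  rewrite id_lfunE /Omega (pair2_tensor_of_End nondeg) id_lfunE formC.
  by rewrite formC scaleN1r subrr.
by rewrite zero_lfunE linear0r add0r (linear_fun0 hl) scaler0.
Qed.

(** * Equivariance *)

(** The action of y on the coordinates differentiates in the direction
    - [y, A], because ([y, X_i], A) = (X_i, - [y, A]). *)
Lemma sum_coord_xd x y : y \in gj B n 0 ->
  \sum_(i < r) \sum_(k < r) (coord X k (br y X`_i) * x k) *: xd i = - br y (point x).
Proof.
move=> hy; have hz : - br y (point x) \in gj B n 0.
  by rewrite rpredN; exact: (gj_br hy (point_mem x)).
rewrite [RHS](xd_expand hz); apply: eq_bigr => i _; rewrite -scaler_suml.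
congr (_ *: _); rewrite formC linearNr /= -(form_br_skew inv lie).
have hyX : br y X`_i \in <<X>>%VS by rewrite span_X; exact: (gj_br hy (X_mem i)).
rewrite [in RHS](coord_span hyX) linear_sumlz /=; apply: eq_bigr => k _.
by rewrite formZl form_X_point.
Qed.

(** The commutator with Y is a derivation of the composition, so on the powers
    of T it is the derivative along the commutator of T and Y. *)
Lemma dpow_commutator (T Y : 'End(g)) k :
  dpow T ((T \o Y)%VF - (Y \o T)%VF) k = (lpow T k \o Y)%VF - (Y \o lpow T k)%VF.
Proof.
elim: k => [|k ihk] /=; first by rewrite comp_lfun1l comp_lfun1r subrr.
rewrite ihk; apply/lfunP => u; rewrite !(add_lfunE, opp_lfunE, comp_lfunE).
by rewrite linearB /= addrC addrA subrK.
Qed.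

Lemma iter_commutator y w k u :
  \sum_(p < k) iter p (br w) (br (- br y w) (iter (k.-1 - p) (br w) u))
  = iter k (br w) (br y u) - br y (iter k (br w) u).
Proof.
rewrite -dpow_adE (_ : ad br (- br y w) = (ad br w \o ad br y)%VF - (ad br y \o ad br w)%VF).
  by rewrite dpow_commutator add_lfunE opp_lfunE !comp_lfunE !lpowE !adE !iter_ad.
apply/lfunP => v; rewrite !(add_lfunE, opp_lfunE, comp_lfunE) !adE.
by rewrite linearNl /= (br_ad lie) opprB.
Qed.

Lemma linear_psderiv (V W : lmodType C) (L : V -> W) (f : pser r V) (i : 'I_r) m : linear L ->
  L (psderiv i f m) = psderiv i (fun m => L (f m)) m.
Proof.
by move=> hL; rewrite /psderiv (linear_funMn _ _ hL).
Qed.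

Lemma linear_psmulX (V W : lmodType C) (L : V -> W) (f : pser r V) (i : 'I_r) m : linear L ->
  L (psmulX i f m) = psmulX i (fun m => L (f m)) m.
Proof.
by move=> hL; rewrite /psmulX; case: ifP => // _; exact: linear_fun0.
Qed.

Lemma eq_psmulX (V : nmodType) (f f' : pser r V) (i : 'I_r) m :
  (forall m, f m = f' m) -> psmulX i f m = psmulX i f' m.
Proof. by move=> e; rewrite /psmulX e. Qed.

Lemma eq_psderiv (V : nmodType) (f f' : pser r V) (i : 'I_r) m :
  (forall m, f m = f' m) -> psderiv i f m = psderiv i f' m.
Proof. by move=> e; rewrite /psderiv e. Qed.

Lemma form_psderiv_rmat m (i : 'I_r) j u v : (j < n)%N -> u \in gj B n j ->
  form (psderiv i rmat m u) v
  = form (psderiv i (pssubst (fun k => cf j k + h k) S) m u) v.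
Proof.
move=> jn hu; rewrite !(linear_psderiv _ _ _ (linear_form_eval u v)).
by apply: eq_psderiv => m'; rewrite (rmatE _ jn hu).
Qed.

Lemma ev_form_psderiv (t : nat -> C) d x (i : 'I_r) u v :
  ev d x (fun m => form (psderiv i (pssubst t S) m u) v : C^o)
  = t d.+1 * form (\sum_(p < d.+1)
      iter p (br (point x)) (br (xd i) (iter (d - p) (br (point x)) u))) v.
Proof.
by rewrite (ev_form_eval d x (psderiv i (pssubst t S))) ev_psderiv_pssubst_ad formZl.
Qed.

Lemma linear_form_sum_iter y d u v : linear (fun w =>
  form (\sum_(p < d.+1) iter p (br y) (br w (iter (d - p) (br y) u))) v : C^o).
Proof.
move=> k w w'; rewrite !linear_sumlz scaler_sumr -big_split; apply: eq_bigr => p _ /=.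
rewrite !(form_iter_skew inv lie) linearDl /= linearZl_LR formDl formZl /=.
by rewrite mulrDr mulrCA.
Qed.

(** The commutator of ad y with f (ad A) is the derivative of f (ad A) in the
    direction [y, A], and the sum is the derivative in the opposite direction. *)
Lemma pssubst_ad_equivariant (t : nat -> C) y u v m : y \in gj B n 0 ->
  form (br y (pssubst t S m u)) v - form (pssubst t S m (br y u)) v
  + \sum_(i < r) \sum_(k < r)
     coord X k (br y X`_i) * psmulX k (fun m => form (psderiv i (pssubst t S) m u) v : C^o) m
  = 0.
Proof.
move=> hy; pose F m : C^o := (form (br y (pssubst t S m u)) v : C^o)
  + -1 *: (form (pssubst t S m (br y u)) v : C^o)
  + \sum_(i < r) \sum_(k < r) coord X k (br y X`_i) *:
      psmulX k (fun m => form (psderiv i (pssubst t S) m u) v : C^o) m.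
suff F0 : forall m, F m = 0 by have := F0 m; rewrite /F scaleN1r.
apply: ev_eq0 => d x; rewrite /F.
rewrite !evD evZ ev_form_pssubst ev_sum.
have -> : ev d x (fun m => form (br y (pssubst t S m u)) v : C^o)
        = t d * form (br y (iter d (br (point x)) u)) v.
  rewrite (@eq_ev _ _ _ _ _ _ (fun m => -1 *: (form (pssubst t S m u) (br y v) : C^o))).
    by rewrite evZ ev_form_pssubst [form (br y _) v](form_br_skew inv lie) scaleN1r mulrN.
  by move=> m' _; rewrite (form_br_skew inv lie) scaleN1r.
under eq_bigr => i _ do rewrite ev_sum.
under eq_bigr => i _ do under eq_bigr => k _ do rewrite evZ.
case: d => [|d].
  rewrite big1 ?addr0 /= => [|i _]; first by rewrite scaleN1r subrr.
  by apply: big1 => k _; rewrite ev0_psmulX scaler0.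
under eq_bigr => i _ do under eq_bigr => k _ do rewrite ev_psmulX ev_form_psderiv.
have -> : \sum_(i < r) \sum_(k < r) coord X k (br y X`_i) *: (x k *: (t d.+1 *
    form (\sum_(p < d.+1) iter p (br (point x)) (br (xd i) (iter (d - p) (br (point x)) u))) v) : C^o)
  = t d.+1 * form (\sum_(p < d.+1) iter p (br (point x)) (br (- br y (point x)) (iter (d - p) (br (point x)) u))) v.
  rewrite -(sum_coord_xd x hy) (linear_fun_sum _ _ _ (linear_form_sum_iter _ _ _ _)).
  rewrite mulr_sumr; apply: eq_bigr => i _.
  rewrite [in RHS](linear_fun_sum _ _ _ (linear_form_sum_iter _ _ _ _)) [RHS]mulr_sumr.
  apply: eq_bigr => k _; rewrite (linear_fun_scale _ _ (linear_form_sum_iter _ _ _ _)).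
  by rewrite /GRing.scale /=; ring.
rewrite (iter_commutator y (point x) d.+1 u) formDl formNl scaleN1r.
by ring.
Qed.

Lemma pair2_eq0_gj t : (forall j u v, (j < n)%N -> u \in gj B n j ->
  pair2 form t u v = 0) -> t = 0.
Proof.
move=> ht; apply: (pair2_eq0 nondeg) => u v; move: u.
by apply: (gj_ind (pair2_linearl form t v)) => j u jn hu; exact: (ht j u v jn hu).
Qed.

Lemma pair3_eq0_gj t : (forall i j k a b c, (i < n)%N -> (j < n)%N -> (k < n)%N ->
    a \in gj B n i -> b \in gj B n j -> c \in gj B n k -> pair3 form t a b c = 0) ->
  t = 0.
Proof.
move=> ht; apply: (pair3_eq0 nondeg) => a b c; move: a.
apply: (gj_ind (pair3_linear1 form t b c)) => i a il ha; move: b.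
apply: (gj_ind (pair3_linear2 form t a c)) => j b jl hb; move: c.
by apply: (gj_ind (pair3_linear3 form t a b)) => k c kl hc; exact: (ht i j k a b c il jl kl ha hb hc).
Qed.

Lemma pair2_psderiv m (i : 'I_r) u v :
  pair2 form (psderiv i (r_B br form B n X) m) u v = form (psderiv i rmat m u) v.
Proof.
rewrite (linear_psderiv _ _ _ (pair2_linear form u v)).
rewrite (linear_psderiv rmat i m (linear_form_eval u v)).
by apply: eq_psderiv => m'; rewrite r_BE (pair2_tensor_of_End nondeg).
Qed.

Lemma r_B_equivariant : equivariant br (gj B n 0) X (r_B br form B n X).
Proof.
move=> y hy m; apply: pair2_eq0_gj => j u v jn hu.
have hl := pair2_linear form u v.
have pD s t : pair2 form (s + t) u v = pair2 form s u v + pair2 form t u v.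
  by have := hl 1 s t; rewrite !scale1r.
have hyu : br y u \in gj B n j := gj_br hy hu.
rewrite r_BE pD (pair2_ad2 inv lie) !(pair2_tensor_of_End nondeg).
rewrite -(pssubst_ad_equivariant (fun k => cf j k + h k) u v m hy).
rewrite (rmatE _ jn hu) (rmatE _ jn hyu) (form_br_skew inv lie) opprD addrC -addrA addrC.
rewrite [- form _ _ - _]addrC addrA.
congr (_ + _).
rewrite (linear_fun_sum _ _ _ hl); apply: eq_bigr => i _.
rewrite (linear_fun_sum _ _ _ hl); apply: eq_bigr => k _.
rewrite (linear_fun_scale _ _ hl); congr (_ * _).
rewrite (linear_psmulX _ _ _ hl); apply: eq_psmulX => m'.
by rewrite pair2_psderiv (form_psderiv_rmat _ _ _ jn hu).
Qed.

(** * The dynamical Yang-Baxter equation *)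

Definition form_br_eval a b c (T U : 'End(g)) : C^o := form (br (T b) (U c)) a.

Lemma bilin_form_br_eval a b c : bilin (form_br_eval a b c).
Proof.
split=> [U|T] k x y; rewrite /form_br_eval add_lfunE scale_lfunE.
  exact: (linear_form_br1 _ _ _ _ k (x b) (y b)).
exact: (linear_form_br2 _ _ _ _ k (x c) (y c)).
Qed.

Lemma pair3_dbar m a b c :
  pair3 form (dbar X (r_B br form B n X) m) a b c
  = \sum_(k < r) form X`_k a * form (psderiv k rmat m b) c.
Proof.
rewrite /dbar (linear_fun_sum _ _ _ (pair3_linear form a b c)); apply: eq_bigr => k _.
by rewrite pair3_lift2_tens3 pair2_psderiv.
Qed.

Lemma pair3_CYB m a b c :
  pair3 form (CYB br (r_B br form B n X) m) a b c
  = psmul (form_br_eval a b c) rmat_adj rmat_adj m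
    + psmul (form_br_eval b a c) rmat rmat_adj m
    + psmul (form_br_eval c a b) rmat rmat m.
Proof.
rewrite /CYB /psmul (linear_fun_sum _ _ _ (pair3_linear form a b c)) -!big_split.
apply: eq_bigr => p _ /=; rewrite !r_BE.
by rewrite (pair3_CYB2 br nondeg _ _ _ (rmat_adjP _) (rmat_adjP _)).
Qed.

Section Homogeneous.
Variables (i j k : nat) (a b c : g).
Hypotheses (il : (i < n)%N) (jl : (j < n)%N) (kl : (k < n)%N).
Hypotheses (ha : a \in gj B n i) (hb : b \in gj B n j) (hc : c \in gj B n k).

Lemma ev_dbar_term (t : nat -> C) d x l u v w : (l < n)%N -> u \in gj B n l ->
  ev d x (fun m => \sum_(k0 < r) form X`_k0 u
     *: (form (psderiv k0 (pssubst t S) m v) w : C^o))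
  = (l == 0%N)%:R * t d.+1 * \sum_(p < d.+1)
      form (iter p (br (point x)) (br u (iter (d - p) (br (point x)) v))) w.
Proof.
move=> ll hu; rewrite ev_sum.
under eq_bigr => k0 _ do rewrite evZ ev_form_psderiv.
transitivity (t d.+1 * form (\sum_(p < d.+1) iter p (br (point x))
   (br (\sum_(k0 < r) form X`_k0 u *: xd k0) (iter (d - p) (br (point x)) v))) w).
  rewrite [in RHS](linear_fun_sum _ _ _ (linear_form_sum_iter _ _ _ _)) [RHS]mulr_sumr.
  apply: eq_bigr => k0 _.
  rewrite [in RHS](linear_fun_scale _ _ (linear_form_sum_iter _ _ _ _)).
  by rewrite /GRing.scale /=; ring.
rewrite (sum_xd ll hu) (linear_fun_scale _ _ (linear_form_sum_iter _ _ _ _)).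
by rewrite linear_sumlz /= /GRing.scale /=; ring.
Qed.

Lemma ev_psmul_pssubst (s t : nat -> C) d x u v w :
  ev d x (psmul (form_br_eval w u v) (pssubst s S) (pssubst t S))
  = \sum_(p < d.+1) s p * t (d - p)%N
      * form (br (iter p (br (point x)) u) (iter (d - p) (br (point x)) v)) w.
Proof.
rewrite (ev_psmul _ _ _ _ (bilin_form_br_eval w u v)); apply: eq_bigr => p _.
rewrite /form_br_eval !ev_pssubst_ad linearZl_LR linearZr_LR /= scalerA formZl.
by [].
Qed.

Variables (ci cj ck : nat -> C).

(** The pairing of Alt (dr) + CYB (r) with homogeneous a, b, c, for arbitrary
    coefficient sequences in the place of those of f_i, f_j, f_k. *)
Definition cdybe_component m : C^o :=
  (\sum_(k0 < r) form X`_k0 a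
     *: (form (psderiv k0 (pssubst (fun l => cj l + h l) S) m b) c : C^o))
  + -1 *: (\sum_(k0 < r) form X`_k0 b
     *: (form (psderiv k0 (pssubst (fun l => ci l + h l) S) m a) c : C^o))
  + (\sum_(k0 < r) form X`_k0 c
     *: (form (psderiv k0 (pssubst (fun l => ci l + h l) S) m a) b : C^o))
  + (psmul (form_br_eval a b c) (pssubst (fun l => - cj l + h l) S)
       (pssubst (fun l => - ck l + h l) S) m
     + psmul (form_br_eval b a c) (pssubst (fun l => ci l + h l) S)
       (pssubst (fun l => - ck l + h l) S) m
     + psmul (form_br_eval c a b) (pssubst (fun l => ci l + h l) S)
       (pssubst (fun l => cj l + h l) S) m).

Lemma ev_cdybe_component d x :
  ev d x cdybe_component = trilinear_expr br form (point x) a b c ci cj ck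
    (i == 0%N)%:R (j == 0%N)%:R (k == 0%N)%:R d.
Proof.
rewrite /cdybe_component !evD evZ (ev_dbar_term _ _ _ _ _ il ha).
rewrite (ev_dbar_term _ _ _ _ _ jl hb) (ev_dbar_term _ _ _ _ _ kl hc).
rewrite !ev_psmul_pssubst /trilinear_expr !big_split /= !addr0 scaleN1r.
by [].
Qed.

(** B multiplies the trilinear form by a nontrivial root of unity. *)
Lemma tri_eq0 x p q s : ~~ (n %| i + j + k)%N -> tri br form (point x) a b c p q s = 0.
Proof.
move=> nd; have hbc := gj_br (iter_point_mem p x hb) (iter_point_mem q x hc).
apply: (form_gj hbc (iter_point_mem s x ha)).
by rewrite addnC addnA.
Qed.

End Homogeneous.

Lemma r_B_cdybe m : Alt (dbar X (r_B br form B n X) m) + CYB br (r_B br form B n X) m = 0.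
Proof.
apply: pair3_eq0_gj => i j k a b c il jl kl ha hb hc.
transitivity (cdybe_component a b c (cf i) (cf j) (cf k) m).
  rewrite pair3D pair3_Alt !pair3_dbar pair3_CYB /cdybe_component scaleN1r.
  have add6 (u1 u2 u3 u4 u5 u6 v1 v2 v3 v4 v5 v6 : C) : u1 = v1 -> u2 = v2 -> u3 = v3 ->
    u4 = v4 -> u5 = v5 -> u6 = v6 ->
    u1 - u2 + u3 + (u4 + u5 + u6) = v1 - v2 + v3 + (v4 + v5 + v6).
    by move=> -> -> -> -> -> ->.
  apply: add6.
  - by apply: eq_bigr => k0 _; rewrite (form_psderiv_rmat _ _ _ jl hb).
  - by apply: eq_bigr => k0 _; rewrite (form_psderiv_rmat _ _ _ il ha).
  - by apply: eq_bigr => k0 _; rewrite (form_psderiv_rmat _ _ _ il ha).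
  - by apply: eq_bigr => p _; rewrite /form_br_eval (rmat_adjE _ jl hb) (rmat_adjE _ kl hc).
  - by apply: eq_bigr => p _; rewrite /form_br_eval (rmatE _ il ha) (rmat_adjE _ kl hc).
  - by apply: eq_bigr => p _; rewrite /form_br_eval (rmatE _ il ha) (rmatE _ jl hb).
move: m; apply: ev_eq0 => d x; rewrite (ev_cdybe_component il jl kl ha hb hc).
have [ijk|ijk] := boolP (n %| i + j + k)%N; last first.
  by apply: trilinear_expr_eq0 => // p q s; exact: (tri_eq0 ha hb hc).
have nat_neq0 l : ((l == 0%N)%:R : C) != 0 -> l = 0%N.
  by case: l => [|l] //=; rewrite eqxx.
apply: trilinear_identity => //.
- move=> /nat_neq0 i0 d'; apply: expansion0_f_opp => //.
  by move: ijk; rewrite i0.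
- move=> /nat_neq0 j0 d'; apply: expansion0_f_opp => //.
  by move: ijk; rewrite j0 addn0.
- move=> /nat_neq0 k0 d'; apply: expansion0_f_opp => //.
  by move: ijk; rewrite k0 addn0.
move=> al be ga d' abg al0 be0 ga0.
exact: (expansion0_f_identity d' il jl kl ijk abg al0 be0 ga0).
Qed.

End Grading.

Theorem theoremA (R : realType) (g : vectType R[i])
  (br : {bilinear g -> g -> g}) (hbr : is_lie_bracket br)
  (form : {symmetric g}) (hnondeg : nondegenerate form)
  (hinv : invariant_form br form)
  (B : 'End(g)) (n : nat) (hB : is_lie_automorphism br B)
  (hn : has_order B n) (hBform : forall x y, form (B x) (B y) = form x y)
  (r : nat) (X : r.-tuple g) (hX : basis_of (gj B n 0) X) :
  Dynr br (gj B n 0) X (Omega form) (r_B br form B n X).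
Proof.
split.
- exact: (r_B_equivariant hB hn hBform hnondeg hX hbr hinv).
- exact: (r_B_cdybe hB hn hBform hnondeg hX hbr hinv).
- exact: (r_B_symmetric_part hB hn hBform hnondeg hX hbr hinv).
Qed.
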